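(* For $\mathfrak{g}$ a Leibniz algebra over $\Bbbk$, there is a natural (in $\mathfrak{g}$) $L_\infty$-structure on the desuspension $s^{-1}(\mathsf{Lie}(s\mathfrak{g}), d_{\mathrm{Leib}})$ of the Pirashvili complex that induces the canonical Lie algebra structure on $\mathfrak{g}_{\mathrm{Lie}}$ in homology (up to sign).
   Context: $\Bbbk$ is a field of characteristic zero. Graded vector spaces are homologically $\mathbb{Z}$-graded, with Koszul signs. A (right) Leibniz algebra is a $\Bbbk$-vector space $\mathfrak{g}$ (in degree $0$) with a bilinear product satisfying $x(yz) = (xy)z - (xz)y$. Its associated Lie algebra is $\mathfrak{g}_{\mathrm{Lie}} = \mathfrak{g}/\langle x^2 \mid x\in\mathfrak{g}\rangle_{\Bbbk}$. For a vector space $V$, $sV$ is $V$ placed in homological degree $1$. The Leibniz complex is the tensor algebra $T(s\mathfrak{g})$ with $$d_{\mathrm{Leib}}(sx_1 \otimes \ldots \otimes sx_n) = \sum_{1 \le i<j\le n} (-1)^{j+1}\, sx_1 \otimes \ldots \otimes s(x_ix_j) \otimes \ldots \otimes \widehat{sx_j} \otimes \ldots \otimes sx_n .$$ $\mathsf{Lie}(s\mathfrak{g}) \subset T(s\mathfrak{g})$ is the free graded Lie algebra on $s\mathfrak{g}$, i.e. the Lie subalgebra generated by $s\mathfrak{g}$ under the graded commutator. It is stable under $d_{\mathrm{Leib}}$ and $(\mathsf{Lie}(s\mathfrak{g}), d_{\mathrm{Leib}})$ is the Pirashvili complex; its homology in degree $1$ (degree $0$ after desuspension) is $s\mathfrak{g}_{\mathrm{Lie}}$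 via the canonical surjection $s\mathfrak{g}\to s\mathfrak{g}_{\mathrm{Lie}}$. An $L_\infty$-structure on a graded vector space $W$ is a degree $-1$ coderivation $d$ of the graded symmetric coalgebra $S^*(sW)$ (the Hopf algebra with $sW$ primitive), zero on $S^0$, with $d^2=0$. Write $d_{n,k}$ for the component $S^n(sW) \to S^k(sW)$. It is an $L_\infty$-structure on a complex if $d_{1,1}$ is (the suspension of) the given differential. Here $sW = \mathsf{Lie}(s\mathfrak{g})$ and $d_{1,1} = d_{\mathrm{Leib}}$. Natural means that for every morphism $\mathfrak{g}\to\mathfrak{g}'$ of Leibniz algebras the induced map $S^*(\mathsf{Lie}(s\mathfrak{g}))\to S^*(\mathsf{Lie}(s\mathfrak{g}'))$ commutes with the differentials. Inducing the canonical Lie structure up to sign means that the map $S^2(s\mathfrak{g}_{\mathrm{Lie}}) \to s\mathfrak{g}_{\mathrm{Lie}}$ induced by $d_{2,1}$ on homology is $(s\overline{x})(s\overline{y}) \mapsto \pm s[\overline{x},\overline{y}]$, with a fixed sign. *)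

(* Defs.v *)
(* Arbitrary subspaces are made decidable classically ([boolp]), so that
   quotient vector spaces are [eq_quot] quotients; free vector spaces are the
   [{malg K[X]}] of multinomials. Basic operations are locked because otherwise
   unification unfolds them down to representatives of classes. *)
From HB Require Import structures.
From mathcomp Require Import all_boot all_order all_algebra.
From mathcomp Require Import finmap boolp monalg.

Set Implicit Arguments.
Unset Strict Implicit.
Unset Printing Implicit Defensive.

Import GRing.Theory.
Local Open Scope ring_scope.
Local Open Scope quotient_scope.

Section LinearMaps.
Variables (K : fieldType) (V W : lmodType K) (f : V -> W).
Hypothesis fl : linear f.

Lemma lin0 : f 0 = 0.
Proof. by have := fl (-1) 0 0; rewrite scaler0 addr0 scaleN1r addNr. Qed.

Lemma linZ a u : f (a *: u) = a *: f u.
Proof. by have := fl a u 0; rewrite lin0 !addr0. Qed.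

Lemma linD u v : f (u + v) = f u + f v.
Proof. by have := fl 1 u v; rewrite !scale1r. Qed.

Lemma linN u : f (- u) = - f u.
Proof. by rewrite -scaleN1r linZ scaleN1r. Qed.

End LinearMaps.

Section LinearSpan.
Variables (K : fieldType) (V : lmodType K).

Inductive lspan (A : V -> Prop) : V -> Prop :=
| lspan0 : lspan A 0
| lspanP (a : K) u v : A u -> lspan A v -> lspan A (a *: u + v).

Variable A : V -> Prop.

Lemma lspan_mem u : A u -> lspan A u.
Proof.
by move=> Au; rewrite -[u]scale1r -[_ *: u]addr0; apply/lspanP/lspan0.
Qed.

Lemma lspanD u v : lspan A u -> lspan A v -> lspan A (u + v).
Proof.
by move=> hu hv; elim: hu => [|a x y Ax _ IH]; rewrite ?add0r // -addrA; apply: lspanP.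
Qed.

Lemma lspanZ a u : lspan A u -> lspan A (a *: u).
Proof.
elim=> [|b x y Ax _ IH]; first by rewrite scaler0; apply: lspan0.
by rewrite scalerDr scalerA; apply: lspanP.
Qed.

Lemma lspanN u : lspan A u -> lspan A (- u).
Proof. by rewrite -scaleN1r; apply: lspanZ. Qed.

Definition quot_rel (u v : V) : bool := `[< lspan A (u - v) >].

Lemma quot_rel_equiv : equiv_class_of quot_rel.
Proof.
split=> [u|u v|v u w].
- by apply/asboolP; rewrite subrr; apply: lspan0.
- by apply/asboolP/asboolP => /lspanN; rewrite opprB.
- move=> /asboolP h1 /asboolP h2; apply/asboolP.
  by rewrite -(subrKA v); apply: lspanD.
Qed.

Canonical quot_equiv := EquivRelPack quot_rel_equiv.

Definition quot := {eq_quot quot_rel}.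
HB.instance Definition _ := Choice.on quot.
HB.instance Definition _ := EqQuotient.on quot.

Definition cls (u : V) : quot := \pi_quot u.

Lemma clsP u v : cls u = cls v <-> lspan A (u - v).
Proof.
by split=> [/eqmodP/asboolP|h] //; apply/eqmodP/asboolP.
Qed.

Lemma repr_cls u : lspan A (repr (cls u) - u).
Proof. by apply/clsP; rewrite /cls reprK. Qed.

Lemma cls_repr q : cls (repr q) = q.
Proof. exact: reprK. Qed.

Fact quot_key : unit. Proof. by []. Qed.
Definition quot_add : quot -> quot -> quot :=
  locked_with quot_key (fun p q => cls (repr p + repr q)).
Definition quot_opp : quot -> quot :=
  locked_with quot_key (fun p => cls (- repr p)).
Definition quot_scale : K -> quot -> quot :=
  locked_with quot_key (fun a p => cls (a *: repr p)).

Lemma cls_addE u v : quot_add (cls u) (cls v) = cls (u + v).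
Proof.
rewrite /quot_add unlock; apply/clsP; rewrite opprD addrACA;
by apply: lspanD; apply: repr_cls.
Qed.

Lemma cls_oppE u : quot_opp (cls u) = cls (- u).
Proof. by rewrite /quot_opp unlock; apply/clsP; rewrite -opprD; apply/lspanN/repr_cls. Qed.

Lemma cls_scaleE a u : quot_scale a (cls u) = cls (a *: u).
Proof. by rewrite /quot_scale unlock; apply/clsP; rewrite -scalerBr; apply/lspanZ/repr_cls. Qed.

Lemma quotW (P : quot -> Prop) : (forall u, P (cls u)) -> forall q, P q.
Proof. by move=> h q; rewrite -[q]cls_repr. Qed.

Fact quot_addA : associative quot_add.
Proof.
by do 3![elim/quotW=> ?]; rewrite !cls_addE addrA.
Qed.
Fact quot_addC : commutative quot_add.
Proof. by do 2![elim/quotW=> ?]; rewrite !cls_addE addrC. Qed.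
Fact quot_add0 : left_id (cls 0) quot_add.
Proof. by elim/quotW=> ?; rewrite !cls_addE add0r. Qed.
Fact quot_addN : left_inverse (cls 0) quot_opp quot_add.
Proof. by elim/quotW=> ?; rewrite cls_oppE !cls_addE addNr. Qed.
HB.instance Definition _ := GRing.isZmodule.Build quot
  quot_addA quot_addC quot_add0 quot_addN.

Fact quot_scaleA a b q : quot_scale a (quot_scale b q) = quot_scale (a * b) q.
Proof. by elim/quotW: q => ?; rewrite !cls_scaleE scalerA. Qed.
Fact quot_scale1 : left_id 1 quot_scale.
Proof. by elim/quotW=> ?; rewrite !cls_scaleE scale1r. Qed.
Fact quot_scaleDr : right_distributive quot_scale +%R.
Proof.
move=> a; do 2![elim/quotW=> ?].
by rewrite /+%R /= !(cls_addE, cls_scaleE) scalerDr.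
Qed.
Fact quot_scaleDl q : {morph quot_scale^~ q : a b / a + b}.
Proof.
move=> a b; elim/quotW: q => u.
by rewrite [RHS]/+%R /= !(cls_addE, cls_scaleE) scalerDl.
Qed.
HB.instance Definition _ := GRing.Zmodule_isLmodule.Build K quot
  quot_scaleA quot_scale1 quot_scaleDr quot_scaleDl.

Fact cls_linear : linear cls.
Proof. by move=> a u v; rewrite -cls_addE -cls_scaleE. Qed.
HB.instance Definition _ := GRing.isLinear.Build K V quot _ cls cls_linear.

End LinearSpan.

Arguments cls {K V A} u.

Section Presented.
Variables (K : fieldType) (X : choiceType) (A : {malg K[X]} -> Prop).

Definition presented := quot A.
HB.instance Definition _ := GRing.Lmodule.on presented.

Fact pgen_key : unit. Proof. by []. Qed.
Definition pgen : X -> presented :=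
  locked_with pgen_key (fun x => cls << x >>).

Lemma pgenE x : pgen x = cls << x >>.
Proof. by rewrite /pgen unlock. Qed.

Variable W : lmodType K.

Definition mlift (f : X -> W) (u : {malg K[X]}) : W :=
  \sum_(x <- msupp u) u@_x *: f x.

Fact plift_key : unit. Proof. by []. Qed.
(** Extension by linearity; meaningful when [f] satisfies the relations, see
    [plift_linear] and [plift_gen]. *)
Definition plift (f : X -> W) : presented -> W :=
  locked_with plift_key (fun q => mlift f (repr q)).

Lemma pliftE f q : plift f q = mlift f (repr q).
Proof. by rewrite /plift unlock. Qed.

Lemma mliftEw f u (D : {fset X}) : (msupp u `<=` D)%fset ->
  mlift f u = \sum_(x <- D) u@_x *: f x.
Proof.
move=> sub; rewrite /mlift (big_fset_incl _ sub) // => x _ xnu.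
by rewrite mcoeff_outdom // scale0r.
Qed.

Fact mlift_linear f : linear (mlift f).
Proof.
move=> a u v; pose D := (msupp u `|` msupp v)%fset.
have su : (msupp u `<=` D)%fset by apply: fsubsetUl.
have sv : (msupp v `<=` D)%fset by apply: fsubsetUr.
have sw : (msupp (a *: u + v)%R `<=` D)%fset.
  apply: (fsubset_trans (msuppD_le _ _)); apply: fsetSU.
  exact: msuppZ_le.
rewrite (mliftEw f su) (mliftEw f sv) (mliftEw f sw) scaler_sumr -big_split.
by apply: eq_bigr => x _; rewrite mcoeffD mcoeffZ scalerDl scalerA.
Qed.
HB.instance Definition _ f :=
  GRing.isLinear.Build K {malg K[X]} W _ (mlift f) (mlift_linear f).

Lemma mliftU f x : mlift f << x >> = f x.
Proof.
rewrite /mlift msuppU oner_eq0 big_seq_fset1 mcoeffUU.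
by rewrite scale1r.
Qed.

Lemma mlift_lspan f u : (forall r, A r -> mlift f r = 0) -> lspan A u ->
  mlift f u = 0.
Proof.
move=> fA; elim=> [|a x y Ax _ IH]; first by rewrite linear0.
by rewrite linearP /= IH fA // scaler0 addr0.
Qed.

Lemma plift_cls f u : (forall r, A r -> mlift f r = 0) ->
  plift f (cls u) = mlift f u.
Proof.
move=> fA; apply/eqP; rewrite -subr_eq0 pliftE -linearB /=.
by apply/eqP/mlift_lspan => //; apply: repr_cls.
Qed.

Lemma plift_linear f : (forall r, A r -> mlift f r = 0) -> linear (plift f).
Proof.
move=> fA a p q; elim/quotW: p => u; elim/quotW: q => v.
by rewrite -linearP !plift_cls // linearP.
Qed.

Lemma plift_gen f x : (forall r, A r -> mlift f r = 0) ->
  plift f (pgen x) = f x.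
Proof. by move=> fA; rewrite pgenE plift_cls // mliftU. Qed.

End Presented.

Lemma presented_ind (K : fieldType) (X : choiceType)
    (A : {malg K[X]} -> Prop) (P : presented A -> Prop) :
  P 0 -> (forall a x q, P q -> P (a *: pgen A x + q)) -> forall q, P q.
Proof.
move=> P0 PD; elim/quotW=> u; rewrite (monalgE u) linear_sum /=.
elim/big_rec: _ => // x q _ Pq; suff -> : cls << u@_x *g x >> =
  u@_x *: pgen A x :> presented A by apply: PD.
rewrite pgenE -linearZ; congr cls.
by apply/malgP => y; rewrite mcoeffZ !mcoeffU mulrnAr mulr1.
Qed.

Definition ksign (K : fieldType) (n : int) : K := (-1) ^ n.
Arguments ksign {K} n.

Lemma ksignD (K : fieldType) m n : ksign (m + n) = ksign m * ksign n :> K.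
Proof. by rewrite /ksign expfzDr // oppr_eq0 oner_eq0. Qed.

Lemma ksign_sqr (K : fieldType) n : ksign n * ksign n = 1 :> K.
Proof. by rewrite /ksign -expfzMl mulrNN mulr1 exp1rz. Qed.

Section TensorAlgebra.
Variables (K : fieldType) (V : lmodType K).

(** Words in [V] modulo multilinearity, i.e. the direct sum of the tensor
    powers of [V]. *)
Variant tensor_rel : {malg K[seq V]} -> Prop :=
  TensorRel s1 s2 (a : K) (x y : V) : tensor_rel
    (<< s1 ++ (a *: x + y) :: s2 >>
       - (a *: << s1 ++ x :: s2 >> + << s1 ++ y :: s2 >>)).

Definition tensor := presented tensor_rel.
HB.instance Definition _ := GRing.Lmodule.on tensor.

Definition tword (s : seq V) : tensor := pgen tensor_rel s.

Lemma tword_lin s1 s2 a x y :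
  tword (s1 ++ (a *: x + y) :: s2) =
  a *: tword (s1 ++ x :: s2) + tword (s1 ++ y :: s2).
Proof.
rewrite /tword !pgenE -linearP; apply/clsP/lspan_mem.
exact: TensorRel.
Qed.

Definition multilinear (W : lmodType K) (f : seq V -> W) :=
  forall s1 s2 a x y, f (s1 ++ (a *: x + y) :: s2) =
                      a *: f (s1 ++ x :: s2) + f (s1 ++ y :: s2).

Lemma multilinear_rel (W : lmodType K) (f : seq V -> W) : multilinear f ->
  forall r, tensor_rel r -> mlift f r = 0.
Proof.
move=> fml r [s1 s2 a x y].
by rewrite linearB linearP /= !mliftU fml subrr.
Qed.

Lemma tensor_ind (P : tensor -> Prop) :
  P 0 -> (forall a s t, P t -> P (a *: tword s + t)) -> forall t, P t.
Proof. exact: presented_ind. Qed.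

Definition tensor_lift (W : lmodType K) (f : seq V -> W) : tensor -> W :=
  plift (A := tensor_rel) f.

Lemma tensor_lift_linear (W : lmodType K) (f : seq V -> W) :
  multilinear f -> linear (tensor_lift f).
Proof. by move=> fml; apply/plift_linear/multilinear_rel. Qed.

Lemma tensor_lift_word (W : lmodType K) (f : seq V -> W) s :
  multilinear f -> tensor_lift f (tword s) = f s.
Proof. by move=> fml; apply/plift_gen/multilinear_rel. Qed.

Definition tmul (u v : tensor) : tensor :=
  tensor_lift (fun s => tensor_lift (fun t => tword (s ++ t)) v) u.

Lemma tmul_mlr s : multilinear (fun t => tword (s ++ t)).
Proof. by move=> s1 s2 a x y; rewrite !catA tword_lin. Qed.

Lemma tmul_mll v :
  multilinear (fun s => tensor_lift (fun t => tword (s ++ t)) v).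
Proof.
move=> s1 s2 a x y; pose L s := tensor_lift_linear (tmul_mlr s).
elim/tensor_ind: v => [|b t v IH].
  have z s : tensor_lift (fun t => tword (s ++ t)) 0 = 0.
    exact: lin0 (L s).
  by rewrite !z scaler0 addr0.
rewrite !L IH !(tensor_lift_word _ (tmul_mlr _)) -!catA !cat_cons.
by rewrite tword_lin !scalerDr !scalerA (mulrC b a) addrACA.
Qed.

Lemma tmul_word s t : tmul (tword s) (tword t) = tword (s ++ t).
Proof.
rewrite /tmul (tensor_lift_word _ (tmul_mll _)).
exact: (tensor_lift_word _ (tmul_mlr _)).
Qed.

Lemma tmul_linearl v : linear (tmul^~ v).
Proof. exact: tensor_lift_linear (tmul_mll v). Qed.

Lemma tmul_linearr u : linear (tmul u).
Proof.
move=> a v w; elim/tensor_ind: u => [|b t u IH].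
  have z x : tmul 0 x = 0.
    exact: lin0 (tmul_linearl x).
  by rewrite !z scaler0 addr0.
rewrite !tmul_linearl IH.
have -> : tmul (tword t) (a *: v + w) = a *: tmul (tword t) v + tmul (tword t) w.
  rewrite /tmul !(tensor_lift_word _ (tmul_mll _)).
  exact: (tensor_lift_linear (tmul_mlr _)).
by rewrite !scalerDr !scalerA (mulrC b a) addrACA.
Qed.

(** The homogeneous elements of the graded Lie subalgebra generated by [V] put
    in degree 1: [lie_elt n u] means that [u] is such an element of degree
    [n]. *)
Inductive lie_elt : int -> tensor -> Prop :=
| lie_elt_gen (x : V) : lie_elt 1 (tword [:: x])
| lie_elt0 n : lie_elt n 0
| lie_eltP n (a : K) u v :
    lie_elt n u -> lie_elt n v -> lie_elt n (a *: u + v)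
| lie_elt_bracket m n u v : lie_elt m u -> lie_elt n v ->
    lie_elt (m + n) (tmul u v - ksign (m * n) *: tmul v u).

Definition lie_pred (n : int) : {pred tensor} := fun u => `[< lie_elt n u >].

Fact lie_pred_closed n : submod_closed (lie_pred n).
Proof.
split=> [|a u v /asboolP hu /asboolP hv]; apply/asboolP.
  exact: lie_elt0.
exact: lie_eltP.
Qed.
HB.instance Definition _ n :=
  GRing.isSubmodClosed.Build K tensor (lie_pred n) (lie_pred_closed n).

(** [lie n] is the degree [n] part of the free graded Lie algebra on [sV]. *)
Record lie (n : int) := Lie { lie_val :> tensor; _ : lie_val \in lie_pred n }.
HB.instance Definition _ n := [isSub for @lie_val n].
HB.instance Definition _ n := [Choice of lie n by <:].
HB.instance Definition _ n := [SubChoice_isSubLmodule of lie n by <:].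

Lemma lie_gen_subproof x : tword [:: x] \in lie_pred 1.
Proof. by apply/asboolP/lie_elt_gen. Qed.

Definition lie_gen (x : V) : lie 1 := Lie (lie_gen_subproof x).

End TensorAlgebra.

Section TensorFunctor.
Variables (K : fieldType) (V V' : lmodType K) (f : {linear V -> V'}).

Definition tensor_map (u : tensor V) : tensor V' :=
  tensor_lift (fun s => tword (map f s)) u.

Lemma tensor_map_ml : multilinear (fun s => tword (map f s)).
Proof. by move=> s1 s2 a x y; rewrite !map_cat /= linearP tword_lin. Qed.

Fact tensor_map_linear : linear tensor_map.
Proof. exact: tensor_lift_linear tensor_map_ml. Qed.
HB.instance Definition _ :=
  GRing.isLinear.Build K (tensor V) (tensor V') _ tensor_map tensor_map_linear.

Lemma tensor_map_word s : tensor_map (tword s) = tword (map f s).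
Proof. exact: (tensor_lift_word _ tensor_map_ml). Qed.

Lemma tensor_mapM u v :
  tensor_map (tmul u v) = tmul (tensor_map u) (tensor_map v).
Proof.
have zl (W : lmodType K) (x : tensor W) : tmul 0 x = 0.
  exact: lin0 (tmul_linearl x).
have zr (W : lmodType K) (x : tensor W) : tmul x 0 = 0.
  exact: lin0 (tmul_linearr x).
elim/tensor_ind: u => [|a s u IHu]; first by rewrite !(zl, linear0).
rewrite linearP /= !tmul_linearl linearP /= IHu tensor_map_word.
congr (_ *: _ + _); elim/tensor_ind: v {IHu} => [|b t v IHv].
  by rewrite !(zr, linear0).
rewrite linearP /= !tmul_linearr linearP /= IHv tensor_map_word.
by rewrite !tmul_word tensor_map_word map_cat.
Qed.

Lemma tensor_map_lie n u : lie_elt n u -> lie_elt n (tensor_map u).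
Proof.
elim=> [x|{}n|{}n a {}u v _ hu _ hv|m {}n {}u v _ hu _ hv].
- by rewrite tensor_map_word; apply: lie_elt_gen.
- by rewrite linear0; apply: lie_elt0.
- by rewrite linearP; apply: lie_eltP.
- by rewrite linearB linearZ /= !tensor_mapM; apply: lie_elt_bracket.
Qed.

Lemma lie_map_subproof n (u : lie V n) :
  tensor_map (lie_val u) \in lie_pred n.
Proof. by apply/asboolP/tensor_map_lie/asboolP; case: u. Qed.

Definition lie_map n (u : lie V n) : lie V' n := Lie (lie_map_subproof u).

Lemma lie_map_linear n : linear (@lie_map n).
Proof. by move=> a u v; apply: val_inj; rewrite /= linearP. Qed.

End TensorFunctor.

HB.mixin Record Lmodule_isLeibniz (K : fieldType) g of GRing.Lmodule K g := {
  leib : g -> g -> g;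
  leib_linearl : forall z, linear (leib^~ z);
  leib_linearr : forall x, linear (leib x);
  leibE : forall x y z,
    leib x (leib y z) = leib (leib x y) z - leib (leib x z) y
}.

#[short(type="leibnizType")]
HB.structure Definition Leibniz (K : fieldType) :=
  { g of Lmodule_isLeibniz K g & GRing.Lmodule K g }.

Section Leibniz.
Variables (K : fieldType) (g : leibnizType K).
Implicit Types (x y : g) (s : seq g).

(** The word [s] with letter [i] replaced by [x_i x_j] and letter [j] removed;
    letters are numbered from 0. *)
Definition leib_contract s (i j : nat) : seq g :=
  [seq (if l == i then leib s`_i s`_j else s`_l)
     | l <- iota 0 (size s) & l != j].

(** As letters are numbered from 0, the sign is [(-1)^j], and not
    [(-1)^(j+1)]. *)
Definition dLeib_word s : tensor g :=
  \sum_(j < size s) \sum_(i < j) (-1) ^+ j *: tword (leib_contract s i j).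

Definition dLeib (u : tensor g) : tensor g := tensor_lift dLeib_word u.

Lemma tword_map_lin (I : eqType) (r : seq I) p (a : K) (f1 f2 f3 : I -> g) :
    uniq r -> p \in r -> f1 p = a *: f2 p + f3 p ->
    {in r, forall l, l != p -> f2 l = f1 l} ->
    {in r, forall l, l != p -> f3 l = f1 l} ->
  tword (map f1 r) = a *: tword (map f2 r) + tword (map f3 r).
Proof.
move=> + pr; case/splitPr: pr => r1 r2; rewrite cat_uniq /= => /and3P[_].
rewrite negb_or => /andP[pr1 _] /andP[pr2 _] e1 e2 e3.
have E h : {in r1 ++ p :: r2, forall l, l != p -> h l = f1 l} ->
    map h r1 = map f1 r1 /\ map h r2 = map f1 r2.
  move=> e; split; apply/eq_in_map => l lr; apply: e.
  - by rewrite mem_cat lr.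
  - by apply: contraNneq pr1 => <-.
  - by rewrite mem_cat inE lr !orbT.
  - by apply: contraNneq pr2 => <-.
by rewrite !map_cat /= e1 tword_lin; case: (E _ e2) => -> ->;
  case: (E _ e3) => -> ->.
Qed.

Lemma dLeib_ml : multilinear dLeib_word.
Proof.
move=> s1 s2 a x y; rewrite /dLeib_word !size_cat /=.
set n := (size s1 + (size s2).+1)%N.
rewrite scaler_sumr -big_split; apply: eq_bigr => j _ /=.
rewrite scaler_sumr -big_split; apply: eq_bigr => i _ /=.
rewrite scalerA (mulrC a) -scalerA -scalerDr; congr (_ *: _).
rewrite /leib_contract !size_cat /= -/n; set p := size s1.
have nthp z : (s1 ++ z :: s2)`_p = z by rewrite nth_cat ltnn subnn.
have nthNp z l : l != p -> (s1 ++ z :: s2)`_l = (s1 ++ 0 :: s2)`_l.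
  move=> lp; rewrite !nth_cat; case: ltnP => // ple.
  have : (p < l)%N by rewrite ltn_neqAle eq_sym lp.
  by rewrite -subn_gt0; case: (l - _)%N.
have ltjn : (j < n)%N := ltn_ord j; have ltij : (i < j)%N := ltn_ord i.
move: (nat_of_ord i) ltij => {}i ltij.
move: (nat_of_ord j) ltij ltjn => {}j ltij ltjn.
have ur : uniq [seq l <- iota 0 n | l != j] by rewrite filter_uniq ?iota_uniq.
have ltpn : (p < n)%N by rewrite /n addnS ltnS leq_addr.
have ir : i \in [seq l <- iota 0 n | l != j].
  by rewrite mem_filter mem_iota /= (ltn_trans ltij) // ltn_eqF.
have [jp|jp] := eqVneq j p.
  have ip : i != p by rewrite -jp ltn_eqF.
  apply: (tword_map_lin (p := i)) => //=; rewrite ?eqxx.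
  - by rewrite jp !nthp !(nthNp _ _ ip) leib_linearr.
  - move=> l; rewrite mem_filter jp => /andP[lp _] li.
    by rewrite (negPf li) !(nthNp _ _ lp).
  - move=> l; rewrite mem_filter jp => /andP[lp _] li.
    by rewrite (negPf li) !(nthNp _ _ lp).
have pr : p \in [seq l <- iota 0 n | l != j].
  by rewrite mem_filter mem_iota eq_sym jp.
apply: (tword_map_lin (p := p)) => //=.
- by rewrite !(nthNp _ _ jp); case: eqP => [<-|_]; rewrite !nthp ?leib_linearl.
- move=> l _ lp; rewrite !(nthNp _ _ jp) !(nthNp _ _ lp).
  by case: (eqVneq l i) => // <-; rewrite !(nthNp _ _ lp).
- move=> l _ lp; rewrite !(nthNp _ _ jp) !(nthNp _ _ lp).
  by case: (eqVneq l i) => // <-; rewrite !(nthNp _ _ lp).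
Qed.

Fact dLeib_linear : linear dLeib.
Proof. exact: tensor_lift_linear dLeib_ml. Qed.
HB.instance Definition _ :=
  GRing.isLinear.Build K (tensor g) (tensor g) _ dLeib dLeib_linear.

Lemma dLeib_tword s : dLeib (tword s) = dLeib_word s.
Proof. exact: (tensor_lift_word _ dLeib_ml). Qed.

Definition cycle_pred n : {pred lie g n} := fun u => dLeib u == 0.

Fact cycle_pred_closed n : submod_closed (@cycle_pred n).
Proof.
split=> [|a u v /eqP hu /eqP hv]; apply/eqP; first by rewrite linear0.
by rewrite linearP /= hu hv scaler0 addr0.
Qed.
HB.instance Definition _ n := GRing.isSubmodClosed.Build K (lie g n)
  (@cycle_pred n) (@cycle_pred_closed n).

Record cycle (n : int) :=
  Cycle { cycle_val :> lie g n; _ : cycle_val \in @cycle_pred n }.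
HB.instance Definition _ n := [isSub for @cycle_val n].
HB.instance Definition _ n := [Choice of cycle n by <:].
HB.instance Definition _ n := [SubChoice_isSubLmodule of cycle n by <:].

Definition boundary n (z : cycle n) : Prop :=
  exists b : lie g (n + 1), lie_val z = dLeib b.

Definition homology (n : int) := quot (@boundary n).
HB.instance Definition _ n := GRing.Lmodule.on (homology n).

Lemma cycle_gen_subproof x : lie_gen x \in @cycle_pred 1.
Proof.
by apply/eqP; rewrite dLeib_tword /dLeib_word big_ord1 big_ord0.
Qed.
Definition cycle_gen x : cycle 1 := Cycle (cycle_gen_subproof x).

Definition is_square (u : g) : Prop := exists x, u = leib x x.
Definition gLie := quot is_square.
HB.instance Definition _ := GRing.Lmodule.on gLie.

Definition gLie_bracket (p q : gLie) : gLie := cls (leib (repr p) (repr q)).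

Lemma gLie_bracketE x y :
  gLie_bracket (cls x) (cls y) = cls (leib x y).
Proof.
have zl z := lin0 (leib_linearl z); have zr z := lin0 (leib_linearr z).
have Dl z := linD (leib_linearl z); have Dr z := linD (leib_linearr z).
have Nl z := linN (leib_linearl z); have Nr z := linN (leib_linearr z).
have sql z u : lspan is_square u -> lspan is_square (leib u z).
  elim=> [|a _ w [v ->] _ IH]; first by rewrite zl; apply: lspan0.
  rewrite leib_linearl; apply: lspanD => //; apply: lspanZ.
  have -> : leib (leib v v) z = leib (v + leib v z) (v + leib v z)
     - leib v v - leib (leib v z) (leib v z).
    rewrite Dl !Dr leibE.
    set A := leib v v; set B := leib (leib v z) v; set C := leib A z.
    set D := leib (leib v z) (leib v z).
    by rewrite !addrA subrK (addrAC (A + C)) addrK (addrC A) addrK.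
  have sq w' : lspan is_square (leib w' w') by apply: lspan_mem; exists w'.
  by apply: lspanD; [apply: lspanD|]; rewrite ?lspanN //; apply: lspanN.
have sqr z u : lspan is_square u -> lspan is_square (leib z u).
  elim=> [|a _ w [v ->] _ IH]; first by rewrite zr; apply: lspan0.
  by rewrite leib_linearr leibE subrr scaler0 add0r.
apply/clsP; set x' := repr _; set y' := repr _.
have -> : leib x' y' - leib x y = leib (x' - x) y' + leib x (y' - y).
  by rewrite Dl Dr Nl Nr addrA subrK.
by apply: lspanD; [apply: sql|apply: sqr]; apply: repr_cls.
Qed.

End Leibniz.

Section TensorProduct.
Variables (K : fieldType) (M N : lmodType K).

Variant bilin_rel : {malg K[(M * N)%type]} -> Prop :=
| BilinL (a : K) x y z : bilin_rel
    (<< (a *: x + y, z) >> - (a *: << (x, z) >> + << (y, z) >>))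
| BilinR (a : K) x y z : bilin_rel
    (<< (z, a *: x + y) >> - (a *: << (z, x) >> + << (z, y) >>)).

Definition tens := presented bilin_rel.
HB.instance Definition _ := GRing.Lmodule.on tens.

Definition pure (x : M) (y : N) : tens := pgen bilin_rel (x, y).

Lemma pure_linearl y : linear (pure^~ y).
Proof.
move=> a x z; rewrite /pure !pgenE -linearP; apply/clsP/lspan_mem.
exact: BilinL.
Qed.

Lemma pure_linearr x : linear (pure x).
Proof.
move=> a y z; rewrite /pure !pgenE -linearP; apply/clsP/lspan_mem.
exact: BilinR.
Qed.

Lemma tens_ind (P : tens -> Prop) :
  P 0 -> (forall a x y t, P t -> P (a *: pure x y + t)) -> forall t, P t.
Proof. by move=> P0 PD; apply: presented_ind => // a [x y] t; apply: PD. Qed.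

Definition tens_lift (W : lmodType K) (f : M -> N -> W) : tens -> W :=
  plift (A := bilin_rel) (fun p => f p.1 p.2).

Section Lift.
Variables (W : lmodType K) (f : M -> N -> W).
Hypotheses (fl : forall y, linear (f^~ y)) (fr : forall x, linear (f x)).

Lemma bilin_rel_lift r : bilin_rel r -> mlift (fun p => f p.1 p.2) r = 0.
Proof.
by case=> a x y z; rewrite linearB linearP /= !mliftU /= ?fl ?fr subrr.
Qed.

Lemma tens_lift_linear : linear (tens_lift f).
Proof. exact/plift_linear/bilin_rel_lift. Qed.

Lemma tens_lift_pure x y : tens_lift f (pure x y) = f x y.
Proof. by rewrite /tens_lift /pure plift_gen //; apply: bilin_rel_lift. Qed.

End Lift.
End TensorProduct.

Section TensMap.
Variables (K : fieldType) (M N M' N' : lmodType K).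

(** [f \otimes g], without signs *)
Definition tens_map (f : M -> M') (g : N -> N') : tens M N -> tens M' N' :=
  tens_lift (fun x y => pure (f x) (g y)).

Variables (f : M -> M') (g : N -> N').
Hypotheses (fl : linear f) (gl : linear g).

Let fgl y : linear (fun x => pure (f x) (g y)).
Proof. by move=> a x z; rewrite fl pure_linearl. Qed.

Let fgr x : linear (fun y => pure (f x) (g y)).
Proof. by move=> a y z; rewrite gl pure_linearr. Qed.

Lemma tens_map_linear : linear (tens_map f g).
Proof. exact: tens_lift_linear. Qed.

Lemma tens_map_pure x y : tens_map f g (pure x y) = pure (f x) (g y).
Proof. by rewrite /tens_map tens_lift_pure. Qed.

End TensMap.

Section SymmetricCoalgebra.
Variables (K : fieldType) (V : int -> lmodType K).

Definition homog := {n : int & V n}.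
HB.instance Definition _ := Choice.on homog.

Implicit Types (x y : homog) (s : seq homog).

Definition hdeg s : int := \sum_(x <- s) tag x.

(** Words of homogeneous elements modulo multilinearity and graded
    commutativity. *)
Variant sym_rel : {malg K[seq homog]} -> Prop :=
| SymLin s1 s2 n (a : K) (x y : V n) : sym_rel
    (<< s1 ++ (Tagged V (a *: x + y) : homog) :: s2 >>
       - (a *: << s1 ++ (Tagged V x : homog) :: s2 >>
            + << s1 ++ (Tagged V y : homog) :: s2 >>))
| SymComm s1 s2 (x y : homog) : sym_rel
    (<< s1 ++ x :: y :: s2 >>
       - ksign (tag x * tag y) *: << s1 ++ y :: x :: s2 >>).

Definition sym := presented sym_rel.
HB.instance Definition _ := GRing.Lmodule.on sym.

Definition sword s : sym := pgen sym_rel s.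

Definition sym_incl n (v : V n) : sym := sword [:: Tagged V v].

Lemma sym_ind (P : sym -> Prop) :
  P 0 -> (forall a s t, P t -> P (a *: sword s + t)) -> forall t, P t.
Proof. exact: presented_ind. Qed.

Definition sym_lift (W : lmodType K) (f : seq homog -> W) : sym -> W :=
  plift (A := sym_rel) f.

Section Lift.
Variables (W : lmodType K) (f : seq homog -> W).

Definition sym_compat :=
  (forall s1 s2 n (a : K) (x y : V n),
     f (s1 ++ (Tagged V (a *: x + y) : homog) :: s2) =
       a *: f (s1 ++ (Tagged V x : homog) :: s2)
         + f (s1 ++ (Tagged V y : homog) :: s2)) /\
  (forall s1 s2 (x y : homog), f (s1 ++ x :: y :: s2) =
     ksign (tag x * tag y) *: f (s1 ++ y :: x :: s2)).

Hypothesis fc : sym_compat.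

Lemma sym_rel_lift r : sym_rel r -> mlift f r = 0.
Proof.
case: fc => f1 f2 [s1 s2 n a x y|s1 s2 x y].
  by rewrite linearB linearP /= !mliftU f1 subrr.
by rewrite linearB linearZ /= !mliftU f2 subrr.
Qed.

Lemma sym_lift_linear : linear (sym_lift f).
Proof. exact/plift_linear/sym_rel_lift. Qed.

Lemma sym_lift_sword s : sym_lift f (sword s) = f s.
Proof. exact/plift_gen/sym_rel_lift. Qed.

End Lift.

Lemma sword_compat : sym_compat sword.
Proof.
split=> [s1 s2 n a x y|s1 s2 x y].
  rewrite /sword !pgenE -linearP; apply/clsP/lspan_mem; exact: SymLin.
rewrite /sword !pgenE -linearZ; apply/clsP/lspan_mem; exact: SymComm.
Qed.

Definition sym_cons x : sym -> sym := sym_lift (fun s => sword (x :: s)).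

(** The sign [u |-> (-1)^(p |u|) u], for [u] homogeneous. *)
Definition sym_sign (p : int) : sym -> sym :=
  sym_lift (fun s => ksign (p * hdeg s) *: sword s).

(** Left multiplication by [v \otimes 1 + 1 \otimes v] on the graded algebra
    [S \otimes S]. *)
Definition comult_step x (t : tens sym sym) : tens sym sym :=
  tens_map (sym_cons x) id t + tens_map (sym_sign (tag x)) (sym_cons x) t.

(** The coproduct is the morphism of algebras with
    [v |-> v \otimes 1 + 1 \otimes v] for [v] in [V], see [comult_cons]. *)
Definition comult : sym -> tens sym sym :=
  sym_lift (foldr comult_step (pure (sword [::]) (sword [::]))).

Definition sym_proj (n : nat) : sym -> sym :=
  sym_lift (fun s => if size s == n then sword s else 0).

Definition sym_degree (m : int) : sym -> Prop :=
  lspan (fun u => exists2 s, hdeg s = m & u = sword s).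

Lemma sym_cons_compat x : sym_compat (fun s => sword (x :: s)).
Proof.
case: sword_compat => h1 h2.
by split=> [s1 s2 n a y z|s1 s2 y z]; rewrite -!cat_cons (h1, h2).
Qed.

Lemma hdeg_cat s1 s2 : hdeg (s1 ++ s2) = hdeg s1 + hdeg s2.
Proof. exact: big_cat. Qed.

Lemma hdeg_cons x s : hdeg (x :: s) = tag x + hdeg s.
Proof. exact: big_cons. Qed.

Lemma sym_sign_compat p : sym_compat (fun s => ksign (p * hdeg s) *: sword s).
Proof.
case: sword_compat => h1 h2; split=> [s1 s2 n a y z|s1 s2 y z].
  rewrite !hdeg_cat !hdeg_cons /= h1 scalerDr !scalerA.
  by rewrite (mulrC a).
rewrite !hdeg_cat !hdeg_cons h2 !scalerA (addrCA (tag y)).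
by rewrite (mulrC (ksign (tag y * tag z))).
Qed.

Lemma sym_proj_compat n :
  sym_compat (fun s => if size s == n then sword s else 0).
Proof.
case: sword_compat => h1 h2; split=> [s1 s2 m a y z|s1 s2 y z].
  by rewrite !size_cat /=; case: ifP => _; [rewrite h1 | rewrite scaler0 addr0].
by rewrite !size_cat /=; case: ifP => _; [rewrite h2 | rewrite scaler0].
Qed.

Lemma sym_cons_linear x : linear (sym_cons x).
Proof. exact: sym_lift_linear (sym_cons_compat x). Qed.

Lemma sym_sign_linear p : linear (sym_sign p).
Proof. exact: sym_lift_linear (sym_sign_compat p). Qed.

Lemma sym_proj_linear n : linear (sym_proj n).
Proof. exact: sym_lift_linear (sym_proj_compat n). Qed.

Lemma sym_cons_sword x s : sym_cons x (sword s) = sword (x :: s).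
Proof. exact: (sym_lift_sword (sym_cons_compat x) s). Qed.

Lemma sym_sign_sword p s :
  sym_sign p (sword s) = ksign (p * hdeg s) *: sword s.
Proof. exact: (sym_lift_sword (sym_sign_compat p) s). Qed.

Lemma sym_proj_sword n s :
  sym_proj n (sword s) = if size s == n then sword s else 0.
Proof. exact: (sym_lift_sword (sym_proj_compat n) s). Qed.

HB.instance Definition _ x :=
  GRing.isLinear.Build K sym sym _ (sym_cons x) (sym_cons_linear x).
HB.instance Definition _ p :=
  GRing.isLinear.Build K sym sym _ (sym_sign p) (sym_sign_linear p).
HB.instance Definition _ n :=
  GRing.isLinear.Build K sym sym _ (sym_proj n) (sym_proj_linear n).

Lemma id_linear (W : lmodType K) : linear (@id W).
Proof. by []. Qed.

Lemma comult_step_pure x u v : comult_step x (pure u v) =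
  pure (sym_cons x u) v + pure (sym_sign (tag x) u) (sym_cons x v).
Proof.
rewrite /comult_step (tens_map_pure (sym_cons_linear x) (@id_linear _)).
by rewrite (tens_map_pure (sym_sign_linear _) (sym_cons_linear x)).
Qed.

Lemma comult_step_linear x : linear (comult_step x).
Proof.
move=> a u v; rewrite /comult_step.
rewrite (tens_map_linear (sym_cons_linear x) (@id_linear _)).
rewrite (tens_map_linear (sym_sign_linear _) (sym_cons_linear x)).
by rewrite scalerDr addrACA.
Qed.
HB.instance Definition _ x := GRing.isLinear.Build K (tens sym sym)
  (tens sym sym) _ (comult_step x) (comult_step_linear x).

Lemma sym_cons_lin n (a : K) (v w : V n) u :
  sym_cons (Tagged V (a *: v + w)) u =
  a *: sym_cons (Tagged V v) u + sym_cons (Tagged V w) u.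
Proof.
case: sword_compat => h1 _.
elim/sym_ind: u => [|b s u IH]; first by rewrite !linear0 ?scaler0 addr0.
rewrite !linearP /= IH !sym_cons_sword (h1 [::]) !scalerDr !scalerA.
by rewrite (mulrC b a) addrACA.
Qed.

Lemma sym_consC x y u :
  sym_cons x (sym_cons y u) =
  ksign (tag x * tag y) *: sym_cons y (sym_cons x u).
Proof.
case: sword_compat => _ h2.
elim/sym_ind: u => [|b s u IH]; first by rewrite !linear0 ?scaler0.
by rewrite !linearP /= IH !sym_cons_sword (h2 [::]).
Qed.

Lemma sym_sign_cons p x u :
  sym_sign p (sym_cons x u) = ksign (p * tag x) *: sym_cons x (sym_sign p u).
Proof.
elim/sym_ind: u => [|b s u IH]; first by rewrite !linear0 ?scaler0.
rewrite !linearP /= IH sym_cons_sword !sym_sign_sword.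
rewrite (linZ (sym_cons_linear x)) sym_cons_sword hdeg_cons mulrDr ksignD.
by rewrite !scalerA mulrA.
Qed.

Lemma sym_signC p q u : sym_sign p (sym_sign q u) = sym_sign q (sym_sign p u).
Proof.
elim/sym_ind: u => [|b s u IH]; first by rewrite !linear0.
rewrite !linearP /= IH !sym_sign_sword !(linZ (sym_sign_linear _)).
by rewrite !sym_sign_sword !scalerA (mulrAC b).
Qed.

Lemma comult_stepC x y t : comult_step x (comult_step y t) =
  ksign (tag x * tag y) *: comult_step y (comult_step x t).
Proof.
have pZl a u v : pure (a *: u) v = a *: pure u v :> tens sym sym.
  exact: linZ (pure_linearl v) _ _.
have pZr a u v : pure u (a *: v) = a *: pure u v :> tens sym sym.
  exact: linZ (pure_linearr u) _ _.
elim/tens_ind: t => [|b u v t IH]; first by rewrite !linear0 ?scaler0.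
rewrite !linearP /= IH; congr (_ *: _ + _).
rewrite !comult_step_pure !(linD (comult_step_linear _)) !comult_step_pure.
rewrite (sym_consC x y u) (sym_consC x y v) !sym_sign_cons (sym_signC _ (tag y)).
rewrite !pZl !pZr !scalerDr !scalerA (mulrC (tag y) (tag x)) ksign_sqr scale1r.
by rewrite addrACA.
Qed.

Lemma comult_compat :
  sym_compat (foldr comult_step (pure (sword [::]) (sword [::]))).
Proof.
split=> [s1 s2 n a x y|s1 s2 x y]; rewrite !foldr_cat /=; last first.
  by elim: s1 => [|z s1 IH] /=; [exact: comult_stepC | rewrite IH linearZ].
set t := foldr _ _ s2; elim: s1 => [|z s1 IH] /=; last by rewrite IH linearP.
elim/tens_ind: t => [|b u v t IH]; first by rewrite !linear0 ?scaler0 addr0.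
have E : comult_step (Tagged V (a *: x + y)) (pure u v) =
    a *: comult_step (Tagged V x) (pure u v) + comult_step (Tagged V y) (pure u v).
  rewrite !comult_step_pure !sym_cons_lin pure_linearl pure_linearr /=.
  by rewrite scalerDr addrACA.
by rewrite !linearP /= IH E !scalerDr !scalerA (mulrC b a) addrACA.
Qed.

Lemma comult_linear : linear comult.
Proof. exact: sym_lift_linear comult_compat. Qed.
HB.instance Definition _ :=
  GRing.isLinear.Build K sym (tens sym sym) _ comult comult_linear.

Lemma comult_nil : comult (sword [::]) = pure (sword [::]) (sword [::]).
Proof. exact: (sym_lift_sword comult_compat [::]). Qed.

Lemma comult_cons x u : comult (sym_cons x u) = comult_step x (comult u).
Proof.
elim/sym_ind: u => [|b s u IH]; first by rewrite !linear0.
rewrite !linearP /= IH sym_cons_sword.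
by rewrite /comult !(sym_lift_sword comult_compat).
Qed.

End SymmetricCoalgebra.

Section SymmetricFunctor.
Variables (K : fieldType) (V V' : int -> lmodType K).
Variable f : forall n, V n -> V' n.

Definition sym_map : sym V -> sym V' :=
  sym_lift (fun s => sword [seq Tagged V' (f (tagged x)) | x <- s]).

Hypothesis fl : forall n, linear (@f n).

Lemma sym_map_compat :
  sym_compat (fun s => sword [seq Tagged V' (f (tagged x)) | x <- s]).
Proof.
case: (sword_compat V') => h1 h2; split=> [s1 s2 n a x y|s1 s2 x y].
  by rewrite !map_cat /= fl h1.
by rewrite !map_cat /= h2.
Qed.

Lemma sym_map_linear : linear sym_map.
Proof. exact: sym_lift_linear sym_map_compat. Qed.

Lemma sym_map_sword s :
  sym_map (sword s) = sword [seq Tagged V' (f (tagged x)) | x <- s].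
Proof. exact: (sym_lift_sword sym_map_compat s). Qed.

End SymmetricFunctor.

Section Linfty.
Variables (K : fieldType) (V : int -> lmodType K).
Variable d : {linear sym V -> sym V}.

(** [V] is the suspension [sW] of the graded vector space [W] carrying the
    structure. As [d] has degree [-1], the map [id \otimes d] is
    [a \otimes b |-> (-1)^|a| a \otimes d b]. *)
Record Linfty_structure : Prop := {
  Linfty_degree : forall m u, sym_degree m u -> sym_degree (m - 1) (d u);
  Linfty_coderivation : forall u, comult (d u) =
    tens_map d id (comult u) + tens_map (sym_sign (-1)) d (comult u);
  Linfty_unit : d (sword [::]) = 0;
  Linfty_square : forall u, d (d u) = 0
}.

(** The component [S^n -> S^k], extended by 0 to the other [S^m]. *)
Definition component (n k : nat) (u : sym V) : sym V :=
  sym_proj k (d (sym_proj n u)).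

End Linfty.

Section Pirashvili.
Variables (K : fieldType) (g : leibnizType K).

Definition pirashvili (n : int) : lmodType K := lie g n.

Variable d : {linear sym pirashvili -> sym pirashvili}.

Definition extends_dLeib : Prop :=
  forall n (u : lie g n), exists2 v : lie g (n - 1),
    lie_val v = dLeib u &
    component d 1 1 (sym_incl (V := pirashvili) u) =
      sym_incl (V := pirashvili) v.

(** The component [S^2 -> S^1] induces [(-1)^b] times the Lie bracket of the
    associated Lie algebra, when the latter is identified with the homology in
    degree 1 through [x |-> [sx]]. *)
Definition induces_bracket (b : bool) : Prop :=
  exists phi : {linear homology g 1 -> gLie g},
  [/\ bijective phi,
      forall x : g, phi (cls (cycle_gen x)) = cls x &
      forall z1 z2 : cycle g 1, exists2 z : cycle g 1,
        component d 2 1 (sword [:: (Tagged pirashvili (cycle_val z1) : homog _);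
                                   (Tagged pirashvili (cycle_val z2) : homog _)])
          = sym_incl (V := pirashvili) (cycle_val z) &
        phi (cls z) = (-1) ^+ b *: gLie_bracket (phi (cls z1)) (phi (cls z2))].

End Pirashvili.

Definition leibniz_morphism (K : fieldType) (g h : leibnizType K)
  (f : {linear g -> h}) : Prop := forall x y, f (leib x y) = leib (f x) (f y).

Definition pirashvili_map (K : fieldType) (g h : leibnizType K)
    (f : {linear g -> h}) : sym (pirashvili g) -> sym (pirashvili h) :=
  sym_map (V := pirashvili g) (V' := pirashvili h) (fun n => @lie_map K g h f n).

Lemma pirashvili_map_sword (K : fieldType) (g h : leibnizType K)
    (f : {linear g -> h}) (s : seq (homog (pirashvili g))) :
  pirashvili_map f (sword s) =
  sword [seq Tagged (pirashvili h) (lie_map f (tagged x)) | x <- s].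
Proof. exact: (sym_map_sword (fun n => @lie_map_linear K g h f n) s). Qed.

(* Main.v *)
Require Import Defs.
From HB Require Import structures.
From mathcomp Require Import all_boot all_order all_algebra.
From mathcomp Require Import finmap boolp monalg ring zify.

Set Implicit Arguments.
Unset Strict Implicit.
Unset Printing Implicit Defensive.

Import GRing.Theory.
Local Open Scope ring_scope.

(** In a positively graded Lie algebra [L] in characteristic 0, let [E] be the
    Euler operator, which multiplies by the degree. The operators
    [E^-1 ad_x E] represent [L] on itself, and the antisymmetrization of
    [E^-1 [x, E y]] is [[x, y]]. Hence, if [delta x] is the derivation of
    [S(L)] extending [E^-1 ad_x E], then [x |-> (x . _) + delta x] is an action
    of [L] on [S(L)]. For [L] free on [V], acting on 1 gives a morphism of
    coalgebras [psi : T(V) -> S(L)], where the letters of [T(V)] are primitive,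
    with [psi (x u) = x psi(u) + delta x (psi u)] for all [x] in [L]. It fixes
    [L], and its inverse [theta] is found by recursion on the length:
    [theta (x u) = x theta(u) - theta (delta x u)].

    As [d_Leib (w x) = d_Leib(w) x + (-1)^|w| rho_x(w)], where [rho_x] is the
    derivation extending [y |-> y x], the differential [d_Leib] is a coderivation
    of square zero that preserves [L]; the structure is [psi d_Leib theta].
    For letters, [theta (x y) = (x y - y x) / 2], so the component [S^2 -> S^1]
    is [(x, y) |-> - (x y - y x) / 2], with products taken in the Leibniz
    algebra. *)

(** The commutative ring [K + M] with [M * M = 0]; [ring] used in it decides
   identities between linear combinations in the [K]-module [M]. *)
Section SquareZero.
Variables (K : fieldType) (M : lmodType K).

Definition sqz : Type := (K * M)%type.
HB.instance Definition _ := GRing.Zmodule.on sqz.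

Definition sqz_one : sqz := (1, 0).
Definition sqz_mul (x y : sqz) : sqz := (x.1 * y.1, x.1 *: y.2 + y.1 *: x.2).

Fact sqz_mulA : associative sqz_mul.
Proof.
move=> [a u] [b v] [c w]; rewrite /sqz_mul /= mulrA; congr pair.
by rewrite !scalerDr !scalerA addrA (mulrC c a) (mulrC c b).
Qed.
Fact sqz_mulC : commutative sqz_mul.
Proof. by move=> [a u] [b v]; rewrite /sqz_mul /= mulrC addrC. Qed.
Fact sqz_mul1 : left_id sqz_one sqz_mul.
Proof. by move=> [a u]; rewrite /sqz_mul /= mul1r scale1r scaler0 addr0. Qed.
Fact sqz_mulDl : left_distributive sqz_mul +%R.
Proof.
move=> [a u] [b v] [c w]; rewrite /sqz_mul /=; congr pair; rewrite ?mulrDl //.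
by rewrite /= scalerDl scalerDr addrACA.
Qed.
Fact sqz_oner_neq0 : sqz_one != 0.
Proof. by apply/eqP => -[] /eqP; rewrite oner_eq0. Qed.
HB.instance Definition _ := GRing.Zmodule_isComNzRing.Build sqz
  sqz_mulA sqz_mulC sqz_mul1 sqz_mulDl sqz_oner_neq0.

Definition sqz_scal (a : K) : sqz := (a, 0).
Definition sqz_mod (u : M) : sqz := (0, u).

Fact sqz_scal_zmod : zmod_morphism sqz_scal.
Proof. by move=> a b; rewrite /sqz_scal; congr pair; rewrite /= ?subr0. Qed.
HB.instance Definition _ := GRing.isZmodMorphism.Build K sqz sqz_scal sqz_scal_zmod.
Fact sqz_scal_mon : monoid_morphism sqz_scal.
Proof.
split=> // a b; rewrite /sqz_scal; apply/eqP.
by rewrite -pair_eqE /= /pair_eq /= eqxx !scaler0 addr0 eqxx.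
Qed.
HB.instance Definition _ := GRing.isMonoidMorphism.Build K sqz sqz_scal sqz_scal_mon.
Fact sqz_mod_zmod : zmod_morphism sqz_mod.
Proof. by move=> a b; rewrite /sqz_mod; congr pair; rewrite /= ?subr0. Qed.
HB.instance Definition _ := GRing.isZmodMorphism.Build M sqz sqz_mod sqz_mod_zmod.

Lemma sqz_modZ a u : sqz_mod (a *: u) = sqz_scal a * sqz_mod u.
Proof.
apply/eqP; rewrite -pair_eqE /= /pair_eq /= mulr0 eqxx.
by rewrite !scale0r addr0 eqxx.
Qed.

Lemma sqz_modE : ((sqz_mod 0 = 0) * (forall u, sqz_mod (- u) = (- sqz_mod u)%R)
  * (forall u v, sqz_mod (u + v) = (sqz_mod u + sqz_mod v)%R)
  * (forall a u, sqz_mod (a *: u) = (sqz_scal a * sqz_mod u)%R))%type.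
Proof.
split; first split; first split; [exact: raddf0|exact: raddfN|exact: raddfD|exact: sqz_modZ].
Qed.

Lemma sqz_mod_inj : injective sqz_mod.
Proof. by move=> u v []. Qed.

End SquareZero.

(** Identities between Koszul signs are settled by splitting on the value of each sign, since [ring]
    does not know that signs square to 1. *)
Lemma ksignP (K : fieldType) n : {ksign n = 1 :> K} + {ksign n = -1 :> K}.
Proof.
case: (eqVneq (ksign n : K) 1) => [|n1]; [by left | right; apply/eqP].
have /eqP := ksign_sqr K n.
by rewrite -subr_eq0 -expr2 subr_sqr_1 mulf_eq0 subr_eq0 addr_eq0 (negPf n1).
Qed.

Lemma ksignN (K : fieldType) n : ksign (- n) = ksign n :> K.
Proof.
rewrite /ksign -invr_expz.
by case: (ksignP K n); rewrite /ksign => ->; rewrite ?invr1 ?invrN1.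
Qed.

Lemma ksign1 (K : fieldType) : ksign 1 = -1 :> K.
Proof. exact: expr1z. Qed.

Ltac modring := apply: sqz_mod_inj; rewrite ?sqz_modE; ring.

(** * Linearity of composite maps *)

Section LinearCombinators.
Variables (K : fieldType) (U V W : lmodType K).

Lemma lin_id : linear (fun u : U => u). Proof. by []. Qed.

Lemma lin_add (f g : U -> V) : linear f -> linear g -> linear (fun u => f u + g u).
Proof. by move=> fl gl a u v /=; rewrite fl gl scalerDr addrACA. Qed.

Lemma lin_opp (f : U -> V) : linear f -> linear (fun u => - f u).
Proof. by move=> fl a u v /=; rewrite fl opprD scalerN. Qed.

Lemma lin_scale b (f : U -> V) : linear f -> linear (fun u => b *: f u).
Proof. by move=> fl a u v /=; rewrite fl scalerDr !scalerA mulrC. Qed.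

Lemma lin_comp (f : V -> W) (g : U -> V) :
  linear f -> linear g -> linear (fun u => f (g u)).
Proof. by move=> fl gl a u v /=; rewrite gl fl. Qed.

End LinearCombinators.

Lemma lin_tmul_l (K : fieldType) (U V : lmodType K) (f : U -> tensor V) v :
  linear f -> linear (fun u => tmul (f u) v).
Proof. by move=> fl a x y /=; rewrite fl tmul_linearl. Qed.

Lemma lin_pure_l (K : fieldType) (U V W : lmodType K) (f : U -> V) (w : W) :
  linear f -> linear (fun u => pure (f u) w).
Proof. by move=> fl a x y /=; rewrite fl pure_linearl. Qed.

Ltac lin := repeat match goal with
  | |- GRing.linear_for _ (fun u => u) => exact: lin_id
  | |- GRing.linear_for _ id => exact: lin_id
  | |- GRing.linear_for _ (fun u => @?f u + @?g u) => apply: (@lin_add _ _ _ f g)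
  | |- GRing.linear_for _ (fun u => - @?f u) => apply: (@lin_opp _ _ _ f)
  | |- GRing.linear_for _ (fun u => ?a *: @?f u) => apply: (@lin_scale _ _ _ a f)
  | |- GRing.linear_for _ (fun u => tmul (@?f u) ?v) => apply: (@lin_tmul_l _ _ _ f v)
  | |- GRing.linear_for _ (fun u => pure (@?f u) ?v) => apply: (@lin_pure_l _ _ _ _ f v)
  | |- GRing.linear_for _ (fun u => ?f (@?g u)) => apply: (@lin_comp _ _ _ _ f g)
  | |- GRing.linear_for _ (tmul _) => exact: tmul_linearr
  | |- GRing.linear_for _ (pure _) => exact: pure_linearr
  | |- GRing.linear_for _ (tens_map _ _) => apply: tens_map_linear
  | |- GRing.linear_for _ _ => first [assumption | exact: linearP]
  end.

(** * Linear maps that agree on spanning elements *)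

Section Extensionality.
Variables (K : fieldType) (V V' W : lmodType K).

Lemma tensor_ext (f g : tensor V -> W) : linear f -> linear g ->
  (forall s, f (tword s) = g (tword s)) -> f =1 g.
Proof.
move=> fl gl fg; elim/tensor_ind => [|a s u IH]; first by rewrite (lin0 fl) (lin0 gl).
by rewrite fl gl fg IH.
Qed.

Lemma tens_ext (f g : tens V V' -> W) : linear f -> linear g ->
  (forall u v, f (pure u v) = g (pure u v)) -> f =1 g.
Proof.
move=> fl gl fg; elim/tens_ind => [|a u v t IH]; first by rewrite (lin0 fl) (lin0 gl).
by rewrite fl gl fg IH.
Qed.

End Extensionality.

Lemma sym_ext (K : fieldType) (V : int -> lmodType K) (W : lmodType K)
    (f g : sym V -> W) : linear f -> linear g ->
  (forall s, f (sword s) = g (sword s)) -> f =1 g.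
Proof.
move=> fl gl fg; elim/sym_ind => [|a s u IH]; first by rewrite (lin0 fl) (lin0 gl).
by rewrite fl gl fg IH.
Qed.

(** * The tensor algebra *)

Section TensorAlgebraTheory.
Variables (K : fieldType) (V : lmodType K).
Implicit Types (u v w : tensor V) (s t : seq V) (x y : V) (m n p : int).

Lemma tmul1l u : tmul (tword [::]) u = u.
Proof. by move: u; apply: tensor_ext => [||s]; [lin|lin|rewrite tmul_word]. Qed.

Lemma tmul1r u : tmul u (tword [::]) = u.
Proof. by move: u; apply: tensor_ext => [||s]; [lin|lin|rewrite tmul_word cats0]. Qed.

Lemma tmulA u v w : tmul u (tmul v w) = tmul (tmul u v) w.
Proof.
move: u; apply: tensor_ext => [||s]; [lin|lin|].
move: v; apply: tensor_ext => [||t]; [lin|lin|].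
by move: w; apply: tensor_ext => [||r]; [lin|lin|rewrite !tmul_word catA].
Qed.

Lemma tmulDl u v w : tmul (u + v) w = tmul u w + tmul v w.
Proof. exact: linD (tmul_linearl w) u v. Qed.
Lemma tmulNl u w : tmul (- u) w = - tmul u w.
Proof. exact: linN (tmul_linearl w) u. Qed.
Lemma tmulZl a u w : tmul (a *: u) w = a *: tmul u w.
Proof. exact: linZ (tmul_linearl w) a u. Qed.
Lemma tmul0l w : tmul 0 w = 0.
Proof. exact: lin0 (tmul_linearl w). Qed.
Lemma tmulDr u v w : tmul w (u + v) = tmul w u + tmul w v.
Proof. exact: linD (tmul_linearr w) u v. Qed.
Lemma tmulNr u w : tmul w (- u) = - tmul w u.
Proof. exact: linN (tmul_linearr w) u. Qed.
Lemma tmulZr a u w : tmul w (a *: u) = a *: tmul w u.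
Proof. exact: linZ (tmul_linearr w) a u. Qed.
Lemma tmul0r w : tmul w 0 = 0.
Proof. exact: lin0 (tmul_linearr w). Qed.

Definition tmulE := (tmul0l, tmul0r, tmulDl, tmulDr, tmulNl, tmulNr, tmulZl, tmulZr).

Lemma tword_cons x s : tword (x :: s) = tmul (tword [:: x]) (tword s).
Proof. by rewrite tmul_word. Qed.

Lemma tword_rcons x s : tword (rcons s x) = tmul (tword s) (tword [:: x]).
Proof. by rewrite tmul_word cats1. Qed.

Lemma tword1_linear : linear (fun x => tword [:: x]).
Proof. by move=> a x y; rewrite (tword_lin [::]). Qed.

(** The counterpart of [sym_sign] on the tensor algebra, where the degree is the length. *)
Definition tsign p : tensor V -> tensor V :=
  tensor_lift (fun s => ksign (p * (size s)%:Z) *: tword s).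

Lemma tsign_ml p : multilinear (fun s => ksign (p * (size s)%:Z) *: tword s).
Proof.
by move=> s1 s2 a x y; rewrite tword_lin scalerDr !size_cat /= !scalerA mulrC.
Qed.

Fact tsign_linear p : linear (tsign p).
Proof. exact: tensor_lift_linear (tsign_ml p). Qed.
HB.instance Definition _ p :=
  GRing.isLinear.Build K (tensor V) (tensor V) _ (tsign p) (tsign_linear p).

Lemma tsign_word p s : tsign p (tword s) = ksign (p * (size s)%:Z) *: tword s.
Proof. exact: (tensor_lift_word _ (tsign_ml p)). Qed.

Lemma tsignM p u v : tsign p (tmul u v) = tmul (tsign p u) (tsign p v).
Proof.
move: u; apply: tensor_ext => [||s]; [lin|lin|].
move: v; apply: tensor_ext => [||t]; [lin|lin|].
rewrite tmul_word !tsign_word !tmulE tmul_word scalerA size_cat PoszD mulrDr.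
by rewrite ksignD.
Qed.

Definition tensor_degree n : tensor V -> Prop :=
  lspan (fun u => exists2 s, (size s)%:Z = n & u = tword s).

Lemma tensor_degree_word s : tensor_degree (size s) (tword s).
Proof. by apply: lspan_mem; exists s. Qed.

Lemma tensor_degreeM m n u v : tensor_degree m u -> tensor_degree n v ->
  tensor_degree (m + n) (tmul u v).
Proof.
move=> hu hv; elim: hu => [|a _ u' [s <- ->] _ IH]; first by rewrite tmul0l; apply: lspan0.
rewrite tmulDl tmulZl; apply: lspanD => //; apply: lspanZ.
elim: hv {IH} => [|b _ v' [t <- ->] _ IH]; first by rewrite tmul0r; apply: lspan0.
rewrite tmulDr tmulZr tmul_word; apply: lspanP => //.
by exists (s ++ t); rewrite ?size_cat.
Qed.

Lemma lie_eltZ n a u : lie_elt n u -> lie_elt n (a *: u).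
Proof. by move=> hu; rewrite -[_ *: u]addr0; apply/lie_eltP/lie_elt0. Qed.

Lemma lie_elt_degree n u : lie_elt n u -> tensor_degree n u.
Proof.
elim=> [x|{}n|{}n a {}u v _ hu _ hv|m {}n {}u v _ hu _ hv].
- exact: (tensor_degree_word [:: x]).
- exact: lspan0.
- by apply: lspanD => //; apply: lspanZ.
- apply: lspanD; first exact: tensor_degreeM.
  by rewrite addrC; apply/lspanN/lspanZ/tensor_degreeM.
Qed.

Lemma tsign_degree p n u : tensor_degree n u -> tsign p u = ksign (p * n) *: u.
Proof.
elim=> [|a _ v [s <- ->] _ IH]; first by rewrite linear0 scaler0.
by rewrite linearP /= IH tsign_word scalerDr !scalerA mulrC.
Qed.

(** Generators have degree 1 and brackets add degrees. The first alternative is there because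
    [lie_elt n 0] holds for every integer [n]. *)
Lemma lie_elt_gt0 n u : lie_elt n u -> u = 0 \/ (0 < n)%R.
Proof.
elim=> [x|{}n|{}n a {}u v _ hu _ hv|m {}n {}u v _ hu _ hv]; [by right|by left| |].
  by case: hu => [->|]; [case: hv => [->|]; [left; rewrite scaler0 addr0|right]|right].
case: hu => [->|m0]; first by left; rewrite !tmulE scaler0 subr0.
case: hv => [->|n0]; first by left; rewrite !tmulE scaler0 subr0.
by right; apply: Num.Theory.addr_gt0.
Qed.

(** A bracket of two nonzero elements has degree at least 2, so only combinations of generators
    remain. *)
Lemma lie_elt1 u : lie_elt 1 u -> exists x, u = tword [:: x].
Proof.
have h0 : exists x, 0 = tword [:: x] by exists 0; rewrite (lin0 tword1_linear).
suff h n : lie_elt n u -> n = 1 -> exists x, u = tword [:: x] by move/h; apply.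
elim=> [x|{}n|{}n a {}u v _ hu _ hv|m {}n {}u v hu _ hv _].
- by exists x.
- by [].
- move=> n1; case: hu => // x ->; case: hv => // y ->.
  by exists (a *: x + y); rewrite tword1_linear.
- case: (lie_elt_gt0 hu) => [->|m0]; first by rewrite !tmulE scaler0 subr0.
  case: (lie_elt_gt0 hv) => [->|n0]; first by rewrite !tmulE scaler0 subr0.
  by move=> mn; exfalso; lia.
Qed.

End TensorAlgebraTheory.

(** * Derivations of the symmetric algebra *)

Section PureArithmetic.
Variables (K : fieldType) (M N : lmodType K).
Implicit Types (u : M) (v : N).

Lemma pureDl u v u' : pure (u + u') v = pure u v + pure u' v.
Proof. exact: linD (pure_linearl _) _ _. Qed.
Lemma pureDr u v v' : pure u (v + v') = pure u v + pure u v'.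
Proof. exact: linD (pure_linearr _) _ _. Qed.
Lemma pureNl u v : pure (- u) v = - pure u v.
Proof. exact: linN (pure_linearl _) _. Qed.
Lemma pureNr u v : pure u (- v) = - pure u v.
Proof. exact: linN (pure_linearr _) _. Qed.
Lemma pureZl a u v : pure (a *: u) v = a *: pure u v.
Proof. exact: linZ (pure_linearl _) _ _. Qed.
Lemma pureZr a u v : pure u (a *: v) = a *: pure u v.
Proof. exact: linZ (pure_linearr _) _ _. Qed.
Lemma pure0l v : pure 0 v = 0 :> tens M N.
Proof. exact: lin0 (pure_linearl _). Qed.
Lemma pure0r u : pure u 0 = 0 :> tens M N.
Proof. exact: lin0 (pure_linearr _). Qed.

Definition pureE := (pure0l, pure0r, pureDl, pureDr, pureNl, pureNr, pureZl, pureZr).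

End PureArithmetic.

Section SymTheory.
Variables (K : fieldType) (V : int -> lmodType K).
Implicit Types (x y : homog V) (s : seq (homog V)) (u v : sym V).

Lemma sym_signD p q u : sym_sign (p + q) u = sym_sign p (sym_sign q u).
Proof.
move: u; apply: sym_ext => [||s]; [lin|lin|].
by rewrite !sym_sign_sword linearZ /= sym_sign_sword scalerA mulrDl ksignD mulrC.
Qed.

Lemma sym_consD x u v : sym_cons x (u + v) = sym_cons x u + sym_cons x v.
Proof. exact: (linD (sym_cons_linear x)). Qed.

Lemma sym_consZ x a u : sym_cons x (a *: u) = a *: sym_cons x u.
Proof. exact: (linZ (sym_cons_linear x)). Qed.

Lemma sym_consN x u : sym_cons x (- u) = - sym_cons x u.
Proof. exact: (linN (sym_cons_linear x)). Qed.

Lemma sym_cons0 x : sym_cons x 0 = 0 :> sym V.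
Proof. exact: (lin0 (sym_cons_linear x)). Qed.

Definition sym_length k : sym V -> Prop :=
  lspan (fun u => exists2 s, size s = k & u = sword s).

Lemma sym_length_sword s : sym_length (size s) (sword s).
Proof. by apply: lspan_mem; exists s. Qed.

Lemma sym_length_cons x k u : sym_length k u -> sym_length k.+1 (sym_cons x u).
Proof.
elim=> [|a _ v [s <- ->] _ IH]; first by rewrite linear0; apply: lspan0.
by rewrite linearP /= sym_cons_sword; apply: lspanP => //; exists (x :: s).
Qed.

Lemma sym_degree_sword s : sym_degree (hdeg s) (sword s).
Proof. by apply: lspan_mem; exists s. Qed.

Lemma sym_degree_cons x m u : sym_degree m u -> sym_degree (tag x + m) (sym_cons x u).
Proof.
elim=> [|a _ v [s <- ->] _ IH]; first by rewrite linear0; apply: lspan0.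
rewrite linearP /= sym_cons_sword; apply: lspanP => //; exists (x :: s) => //.
exact: hdeg_cons.
Qed.

End SymTheory.

Section Derivation.
Variables (K : fieldType) (V : int -> lmodType K) (p : int).
Variable h : homog V -> homog V.
Implicit Types (x y : homog V) (s : seq (homog V)) (u v : sym V).

(** The derivation of degree [p] extending [h]. As [h] takes values in a sigma type, where sums
    exist only within one degree, its linearity is stated after multiplication into the symmetric
    algebra. *)
Fixpoint sym_der_word s : sym V :=
  if s is y :: s' then sword (h y :: s') + ksign (p * tag y) *: sym_cons y (sym_der_word s')
  else 0.

Definition sym_der : sym V -> sym V := sym_lift sym_der_word.

Hypothesis htag : forall y, tag (h y) = p + tag y.
Hypothesis hlin : forall n (a : K) (y z : V n) u,
  sym_cons (h (Tagged V (a *: y + z))) u =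
  a *: sym_cons (h (Tagged V y)) u + sym_cons (h (Tagged V z)) u.

(** Further letters on the left preserve both relations, so these need checking only on the first
    letters; under an exchange of [y] and [z], the terms with [h y] and [h z] are each matched by
    graded commutativity. *)
Lemma sym_der_compat : sym_compat sym_der_word.
Proof.
have [swl swc] := sword_compat V.
split=> [s1 s2 n a y z|s1 s2 y z].
  elim: s1 => [|x s1 IH] /=.
    rewrite -!(sym_cons_sword (h _)) hlin sym_cons_lin; modring.
  rewrite -!(cat_cons (h x)) swl IH linearP /=; modring.
elim: s1 => [|x s1 IH] /=; last first.
  rewrite -!(cat_cons (h x)) swc IH linearZ /=; modring.
rewrite -!sym_cons_sword !(sym_consD, sym_consZ) (sym_consC z y (sym_der_word s2)).
rewrite (sym_consC (h y) z) (sym_consC y (h z)) !htag !mulrDr !ksignD mulrDl ksignD.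
rewrite (mulrC (tag z)) (mulrC (tag y) p).
by case: (ksignP K (p * tag y)) => ->; case: (ksignP K (p * tag z)) => ->;
  case: (ksignP K (tag y * tag z)) => ->; rewrite ?scalerA; modring.
Qed.

Fact sym_der_linear : linear sym_der.
Proof. exact: sym_lift_linear sym_der_compat. Qed.

Lemma sym_der_nil : sym_der (sword [::]) = 0.
Proof. exact: (sym_lift_sword sym_der_compat [::]). Qed.

Lemma sym_der_cons y u :
  sym_der (sym_cons y u) = sym_cons (h y) u + ksign (p * tag y) *: sym_cons y (sym_der u).
Proof.
have dl := sym_der_linear.
move: u; apply: sym_ext => [||s]; [lin|lin|].
by rewrite !sym_cons_sword /sym_der !(sym_lift_sword sym_der_compat).
Qed.

Lemma sym_sign_der q u : sym_sign q (sym_der u) = ksign (q * p) *: sym_der (sym_sign q u).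
Proof.
have dl := sym_der_linear.
move: u; apply: sym_ext => [||s]; [lin|lin|].
elim: s => [|y s IH].
  by rewrite sym_der_nil sym_sign_sword (linZ dl) sym_der_nil linear0 !scaler0.
rewrite -sym_cons_sword sym_der_cons linearD linearZ /= !sym_sign_cons IH htag.
rewrite (linZ dl) sym_der_cons [in ksign (q * (_ + _))]mulrDr ksignD !sym_consZ; modring.
Qed.

(** A derivation that maps generators to generators is also a coderivation, because generators are
    primitive: both sides vanish on the unit and obey the same rule under multiplication by a
    generator. *)
Lemma comult_der u : comult (sym_der u) =
  tens_map sym_der id (comult u) + tens_map (sym_sign p) sym_der (comult u).
Proof.
have dl := sym_der_linear.
move: u; apply: sym_ext => [||s]; [lin|lin|].
elim: s => [|y s IH].
  rewrite sym_der_nil linear0 comult_nil !tens_map_pure ?sym_der_nil ?pureE ?addr0 //; lin.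
rewrite -sym_cons_sword sym_der_cons linearD linearZ /= !comult_cons IH.
move: (comult _); apply: tens_ext => [||a b]; [lin|lin|].
rewrite !tens_map_pure; do ?lin.
rewrite (linD (comult_step_linear y)) !comult_step_pure.
rewrite !(linD (tens_map_linear dl (@lin_id _ _))).
rewrite !(linD (tens_map_linear (sym_sign_linear p) dl)) !tens_map_pure; do ?lin.
rewrite !sym_der_cons sym_sign_der sym_sign_cons htag sym_signD !pureE (mulrC (tag y)).
rewrite (sym_signC (tag y) p).
by case: (ksignP K (p * tag y)) => ->; modring.
Qed.

Lemma sym_der_length k u : sym_length k u -> sym_length k (sym_der u).
Proof.
have dl := sym_der_linear.
elim=> [|a _ v [s <- ->] _ IH]; first by rewrite (lin0 dl); apply: lspan0.
rewrite dl; apply/lspanD/IH/lspanZ; elim: s {IH} => [|y s IH] /=.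
  by rewrite sym_der_nil; apply: lspan0.
rewrite -sym_cons_sword sym_der_cons; apply: lspanD.
  exact/sym_length_cons/sym_length_sword.
exact/lspanZ/sym_length_cons.
Qed.

Lemma sym_der_degree m u : sym_degree m u -> sym_degree (p + m) (sym_der u).
Proof.
have dl := sym_der_linear.
elim=> [|a _ v [s <- ->] _ IH]; first by rewrite (lin0 dl); apply: lspan0.
rewrite dl; apply/lspanD/IH/lspanZ; elim: s {IH} => [|y s IH] /=.
  by rewrite sym_der_nil; apply: lspan0.
rewrite -sym_cons_sword sym_der_cons hdeg_cons; apply: lspanD.
  by rewrite addrA -htag; apply/sym_degree_cons/sym_degree_sword.
by rewrite addrCA; apply/lspanZ/sym_degree_cons.
Qed.

End Derivation.

(** * The free Lie algebra acting on its symmetric algebra *)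

Section FreeLie.
Variables (K : fieldType) (V : lmodType K).
Hypothesis charK : [pchar K] =i pred0.

(** Convertible to [pirashvili], but available for a bare vector space: [psi] and [theta] do not
    involve the Leibniz product. *)
Definition free_lie (n : int) : lmodType K := lie V n.

Local Notation homogL := (homog free_lie).
Local Notation symL := (sym free_lie).
Implicit Types (x y z : homogL) (u v w : symL) (s : seq homogL).

Lemma intr_neq0 (n : int) : 0 < n -> n%:~R != 0 :> K.
Proof. by case: n => // n n0; move/(pcharf0P K): charK => /(_ n) ->; rewrite -lt0n. Qed.

Definition lie_val_of x : tensor V := lie_val (tagged x).

Lemma lie_val_elt x : lie_elt (tag x) (lie_val_of x).
Proof. by case: x => n [u hu]; apply/asboolP. Qed.

(** Junk value [0] when [t] is not a Lie element of degree [n]. *)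
Definition lie_homog n (t : tensor V) : homogL := Tagged free_lie (insubd (0 : lie V n) t).

Lemma lie_homogE n t : lie_elt n t -> lie_val_of (lie_homog n t) = t.
Proof. by move=> ht; rewrite /lie_val_of /= insubdK //; apply/asboolP. Qed.

(** Degrees equal by integer arithmetic need not be convertible. Rebuilding an element from its
    underlying tensor in the wanted degree avoids transport along such equalities. *)
Lemma lie_homog_val n x : tag x = n -> lie_homog n (lie_val_of x) = x.
Proof. by case: x => m x <-; rewrite /lie_homog valKd. Qed.

Lemma lie_homogP n a t t' : lie_elt n t -> lie_elt n t' ->
  lie_homog n (a *: t + t') =
  Tagged free_lie (a *: tagged (lie_homog n t) + tagged (lie_homog n t')).
Proof.
move=> ht ht'; congr (Tagged _ _); apply: val_inj.
rewrite insubdK; first by rewrite /= !insubdK //; apply/asboolP.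
by apply/asboolP/lie_eltP.
Qed.

Lemma lie_homog0 n : lie_homog n 0 = Tagged free_lie (0 : lie V n).
Proof. by congr (Tagged _ _); apply: val_inj; rewrite insubdK //; apply/asboolP/lie_elt0. Qed.

Lemma sym_cons_lieD n t t' u : lie_elt n t -> lie_elt n t' ->
  sym_cons (lie_homog n (t + t')) u =
  sym_cons (lie_homog n t) u + sym_cons (lie_homog n t') u.
Proof. by move=> ht ht'; rewrite -[t]scale1r lie_homogP // sym_cons_lin !scale1r. Qed.

Lemma sym_cons_lie0 n u : sym_cons (lie_homog n 0) u = 0.
Proof.
rewrite lie_homog0; have := sym_cons_lin (V := free_lie) (-1) (0 : lie V n) 0 u.
by rewrite scaler0 addr0 scaleN1r addNr.
Qed.

Lemma sym_cons_lieZ n a t u : lie_elt n t ->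
  sym_cons (lie_homog n (a *: t)) u = a *: sym_cons (lie_homog n t) u.
Proof.
move=> ht; rewrite -[a *: t]addr0 lie_homogP //; last exact: lie_elt0.
by rewrite sym_cons_lin sym_cons_lie0 addr0.
Qed.

Definition tbracket (m n : int) (a b : tensor V) : tensor V :=
  tmul a b - ksign (m * n) *: tmul b a.

Lemma lie_bracket_subproof x y :
  tbracket (tag x) (tag y) (lie_val_of x) (lie_val_of y) \in lie_pred (tag x + tag y).
Proof. by apply/asboolP/lie_elt_bracket; apply: lie_val_elt. Qed.

Definition lie_bracket x y : lie V (tag x + tag y) := Lie (lie_bracket_subproof x y).

Definition bracket x y : homogL := Tagged free_lie (lie_bracket x y).

(** [E^-1 [x, E y]]; when the scalar involves a division by 0, one of [x], [y]
    has degree at most 0 and the bracket vanishes. *)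
Definition euler_bracket x y : homogL := Tagged free_lie
  (((tag y)%:~R / (tag x + tag y)%:~R) *: lie_bracket x y : free_lie (tag x + tag y)).

Lemma bracketE x y : lie_val_of (bracket x y) =
  tbracket (tag x) (tag y) (lie_val_of x) (lie_val_of y).
Proof. by []. Qed.

Lemma euler_bracketE x y : lie_val_of (euler_bracket x y) =
  ((tag y)%:~R / (tag x + tag y)%:~R) *:
    tbracket (tag x) (tag y) (lie_val_of x) (lie_val_of y).
Proof. by []. Qed.

Lemma tbracketC m n a b : tbracket n m b a = - ksign (m * n) *: tbracket m n a b.
Proof. by rewrite /tbracket (mulrC n); case: (ksignP K (m * n)) => ->; modring. Qed.

Lemma tbracket0l m n b : tbracket m n 0 b = 0.
Proof. by rewrite /tbracket !tmulE scaler0 subr0. Qed.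

Lemma tbracket0r m n b : tbracket m n b 0 = 0.
Proof. by rewrite /tbracket !tmulE scaler0 subr0. Qed.

Lemma tbracketZr m n c a b : tbracket m n a (c *: b) = c *: tbracket m n a b.
Proof. by rewrite /tbracket !tmulE; modring. Qed.

Lemma tbracketDr m n a b c : tbracket m n a (b + c) = tbracket m n a b + tbracket m n a c.
Proof. by rewrite /tbracket !tmulE; modring. Qed.

Lemma tbracketZl m n c a b : tbracket m n (c *: a) b = c *: tbracket m n a b.
Proof. by rewrite /tbracket !tmulE; modring. Qed.

Lemma tbracketDl m n a b c : tbracket m n (b + c) a = tbracket m n b a + tbracket m n c a.
Proof. by rewrite /tbracket !tmulE; modring. Qed.

(** The graded commutator of an associative product satisfies it; [m], [n], [p] enter only the
    signs, so the tensors need not be homogeneous. *)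
Lemma tbracket_jacobi m n p a b c :
  tbracket (m + n) p (tbracket m n a b) c =
  tbracket m (n + p) a (tbracket n p b c) -
    ksign (m * n) *: tbracket n (m + p) b (tbracket m p a c).
Proof.
rewrite /tbracket !tmulE !tmulA !mulrDr mulrDl !ksignD (mulrC n m).
by case: (ksignP K (m * n)) => ->; case: (ksignP K (m * p)) => ->;
  case: (ksignP K (n * p)) => ->; modring.
Qed.

(** Clears the denominator. It is invertible when both degrees are positive; otherwise one element
    is 0 and so are both sides. *)
Lemma lie_val_euler x y : (tag x + tag y)%:~R *: lie_val_of (euler_bracket x y) =
  (tag y)%:~R *: lie_val_of (bracket x y).
Proof.
rewrite bracketE euler_bracketE scalerA.
case: (lie_elt_gt0 (lie_val_elt x)) => [->|x0]; first by rewrite tbracket0l !scaler0.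
case: (lie_elt_gt0 (lie_val_elt y)) => [->|y0]; first by rewrite tbracket0r !scaler0.
by rewrite mulrCA divff ?mulr1 // intr_neq0 // Num.Theory.addr_gt0.
Qed.

(** By graded antisymmetry, the coefficients [tag y] and [tag x] of the two Euler brackets add up to
    the total degree, which cancels the denominator. The products with [u] avoid comparing the
    degrees [tag x + tag y] and [tag y + tag x] as types. *)
Lemma sym_cons_bracket x y u : sym_cons (bracket x y) u =
  sym_cons (euler_bracket x y) u - ksign (tag x * tag y) *: sym_cons (euler_bracket y x) u.
Proof.
(* Clears the denominator of either Euler bracket, in the common degree [tag x + tag y]. *)
have E x' y' : tag x' + tag y' = tag x + tag y -> (tag x + tag y)%:~R *:
    sym_cons (euler_bracket x' y') u = (tag y')%:~R *:
    sym_cons (lie_homog (tag x + tag y) (lie_val_of (bracket x' y'))) u.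
  move=> e; rewrite -[euler_bracket x' y'](@lie_homog_val (tag x + tag y)) //.
  have he : lie_elt (tag x + tag y) (lie_val_of (euler_bracket x' y')).
    by rewrite -e; apply: (lie_val_elt (euler_bracket x' y')).
  have hb : lie_elt (tag x + tag y) (lie_val_of (bracket x' y')).
    by rewrite -e; apply: (lie_val_elt (bracket x' y')).
  by rewrite -!sym_cons_lieZ // -e lie_val_euler.
(* The degenerate case, where the total degree need not be invertible. *)
have b0 x' y' : lie_val_of x' = 0 \/ lie_val_of y' = 0 ->
    forall v, sym_cons (bracket x' y') v = 0 /\ sym_cons (euler_bracket x' y') v = 0.
  have z z' v : lie_val_of z' = 0 -> sym_cons z' v = 0.
    by move=> e; rewrite -[z'](lie_homog_val (erefl _)) e sym_cons_lie0.
  move=> h v; have e : tbracket (tag x') (tag y') (lie_val_of x') (lie_val_of y') = 0.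
    by case: h => ->; rewrite ?tbracket0l ?tbracket0r.
  by split; apply: z; rewrite ?bracketE ?euler_bracketE e ?scaler0.
have [x0|x0] := lie_elt_gt0 (lie_val_elt x).
  by rewrite (b0 x y _ u).1 ?(b0 x y _ u).2 ?(b0 y x _ u).2 ?scaler0 ?subr0 //; [right|left|left].
have [y0|y0] := lie_elt_gt0 (lie_val_elt y).
  by rewrite (b0 x y _ u).1 ?(b0 x y _ u).2 ?(b0 y x _ u).2 ?scaler0 ?subr0 //; [left|right|right].
have nz : (tag x + tag y)%:~R != 0 :> K by rewrite intr_neq0 // Num.Theory.addr_gt0.
apply: (scalerI nz); rewrite scalerBr scalerA mulrC -scalerA !E //; last exact: addrC.
have hb : lie_elt (tag x + tag y) (lie_val_of (bracket x y)).
  exact: (lie_val_elt (bracket x y)).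
rewrite -[in LHS](lie_homog_val (erefl (tag (bracket x y)))) /=.
rewrite [lie_val_of (bracket y x)]bracketE tbracketC -bracketE.
rewrite sym_cons_lieZ // intrD.
by case: (ksignP K (tag x * tag y)) => ->; modring.
Qed.

End FreeLie.

(** * The Euler action and the map [psi] *)

Section EulerAction.
Variables (K : fieldType) (V : lmodType K).
Hypothesis charK : [pchar K] =i pred0.

Local Notation free_lie := (free_lie V).
Local Notation homogL := (homog free_lie).
Local Notation symL := (sym free_lie).
Implicit Types (x y z : homogL) (u v w : symL) (s : seq homogL).

Lemma euler_bracket_linr x n (a : K) (y z : free_lie n) u :
  sym_cons (euler_bracket x (Tagged free_lie (a *: y + z))) u =
  a *: sym_cons (euler_bracket x (Tagged free_lie y)) u
    + sym_cons (euler_bracket x (Tagged free_lie z)) u.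
Proof.
rewrite -sym_cons_lin; congr (sym_cons (Tagged _ _) u); apply: val_inj => /=.
rewrite /lie_val_of /= tbracketDr tbracketZr; modring.
Qed.

Lemma euler_bracket_linl x n (a : K) (y z : free_lie n) u :
  sym_cons (euler_bracket (Tagged free_lie (a *: y + z)) x) u =
  a *: sym_cons (euler_bracket (Tagged free_lie y) x) u
    + sym_cons (euler_bracket (Tagged free_lie z) x) u.
Proof.
rewrite -sym_cons_lin; congr (sym_cons (Tagged _ _) u); apply: val_inj => /=.
rewrite /lie_val_of /= tbracketDl tbracketZl; modring.
Qed.

Definition delta x : symL -> symL := sym_der (tag x) (euler_bracket x).

Lemma tag_euler x y : tag (euler_bracket x y) = tag x + tag y. Proof. by []. Qed.

Fact delta_linear x : linear (delta x).
Proof. exact: sym_der_linear (tag_euler x) (@euler_bracket_linr x). Qed.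
HB.instance Definition _ x :=
  GRing.isLinear.Build K symL symL _ (delta x) (delta_linear x).

Lemma delta_nil x : delta x (sword [::]) = 0.
Proof. exact: sym_der_nil (tag_euler x) (@euler_bracket_linr x). Qed.

Lemma delta_cons x y u : delta x (sym_cons y u) =
  sym_cons (euler_bracket x y) u + ksign (tag x * tag y) *: sym_cons y (delta x u).
Proof. exact: sym_der_cons (tag_euler x) (@euler_bracket_linr x) y u. Qed.

Lemma delta_linl n (a : K) (x y : free_lie n) u :
  delta (Tagged free_lie (a *: x + y)) u =
  a *: delta (Tagged free_lie x) u + delta (Tagged free_lie y) u.
Proof.
move: u; apply: sym_ext => [||s]; [lin|lin|].
elim: s => [|z s IH]; first by rewrite !delta_nil scaler0 addr0.
rewrite -sym_cons_sword !delta_cons IH euler_bracket_linl sym_consD sym_consZ /=.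
modring.
Qed.

(** The outer Euler operator multiplies by [tag y + tag z], which cancels the inner denominator: the
    composite is [E^-1 ad_x ad_y E]. *)
Lemma euler_bracket_comp x y z :
  lie_val_of (euler_bracket x (euler_bracket y z)) =
  ((tag z)%:~R / (tag x + (tag y + tag z))%:~R) *:
    tbracket (tag x) (tag y + tag z) (lie_val_of x)
      (tbracket (tag y) (tag z) (lie_val_of y) (lie_val_of z)).
Proof.
have := lie_val_euler charK y z; rewrite bracketE => e.
rewrite euler_bracketE tag_euler; set c := (_%:~R)^-1.
have -> : (tag y + tag z)%:~R * c = c * (tag y + tag z)%:~R by rewrite mulrC.
by rewrite -(scalerA c) -[in LHS]tbracketZr e tbracketZr scalerA mulrC.
Qed.

(** Both sides are derivations of degree [tag x + tag y], so the content is their agreement on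
    generators. *)
Lemma delta_bracket x y u : delta (bracket x y) u =
  delta x (delta y u) - ksign (tag x * tag y) *: delta y (delta x u).
Proof.
move: u; apply: sym_ext => [||s]; [lin|lin|].
elim: s => [|z s IH]; first by rewrite !delta_nil !(lin0 (delta_linear _)) scaler0 subr0.
rewrite -sym_cons_sword !delta_cons IH !(linD (delta_linear _), linZ (delta_linear _)) !delta_cons.
rewrite !tag_euler -[tag (bracket x y)]/(tag x + tag y).
rewrite !(mulrDr, mulrDl) !ksignD (mulrC (tag y) (tag x)).
rewrite !(sym_consD, sym_consN, sym_consZ).
(* On generators this is the Jacobi identity conjugated by the Euler operator; the three terms are
   brought to the same degree [N]. *)
have -> : sym_cons (euler_bracket (bracket x y) z) (sword s) =
    sym_cons (euler_bracket x (euler_bracket y z)) (sword s) -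
    ksign (tag x * tag y) *: sym_cons (euler_bracket y (euler_bracket x z)) (sword s).
  have [e1 e2] : tag x + (tag y + tag z) = tag x + tag y + tag z /\
                 tag y + (tag x + tag z) = tag x + tag y + tag z by split; ring.
  pose N := tag x + tag y + tag z.
  rewrite -[euler_bracket (bracket x y) z](@lie_homog_val _ _ N) //.
  rewrite -[euler_bracket x (euler_bracket y z)](@lie_homog_val _ _ N) //.
  rewrite -[euler_bracket y (euler_bracket x z)](@lie_homog_val _ _ N) //.
  rewrite -scaleNr -sym_cons_lieZ; last first.
    by rewrite /N -e2; exact: (lie_val_elt (euler_bracket y (euler_bracket x z))).
  rewrite -sym_cons_lieD; first last.
  - by apply: lie_eltZ; rewrite /N -e2; exact: (lie_val_elt (euler_bracket y (euler_bracket x z))).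
  - by rewrite /N -e1; exact: (lie_val_elt (euler_bracket x (euler_bracket y z))).
  congr (sym_cons (lie_homog _ _) _).
  rewrite !euler_bracket_comp euler_bracketE bracketE tbracket_jacobi e1 e2; modring.
case: (ksignP K (tag x * tag y)) => ->; case: (ksignP K (tag x * tag z)) => ->;
  case: (ksignP K (tag y * tag z)) => ->; modring.
Qed.

Definition euler_act x u : symL := sym_cons x u + delta x u.

Fact euler_act_linear x : linear (euler_act x).
Proof. by rewrite /euler_act; lin. Qed.
HB.instance Definition _ x :=
  GRing.isLinear.Build K symL symL _ (euler_act x) (euler_act_linear x).

Lemma euler_act_linl n (a : K) (x y : free_lie n) u :
  euler_act (Tagged free_lie (a *: x + y)) u =
  a *: euler_act (Tagged free_lie x) u + euler_act (Tagged free_lie y) u.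
Proof. by rewrite /euler_act sym_cons_lin delta_linl; modring. Qed.

(** Products with [x] and [y] commute up to sign, and [delta] is a representation. The mixed terms
    leave two Euler brackets, which [sym_cons_bracket] adds up to the product with [bracket x y]. *)
Lemma euler_act_bracket x y u : euler_act (bracket x y) u =
  euler_act x (euler_act y u) - ksign (tag x * tag y) *: euler_act y (euler_act x u).
Proof.
rewrite /euler_act !(sym_consD, linD (delta_linear _)) !delta_cons.
rewrite delta_bracket (sym_cons_bracket charK).
rewrite (sym_consC x y) (mulrC (tag y)).
by case: (ksignP K (tag x * tag y)) => ->; modring.
Qed.

Definition lie_letter (x : V) : homogL := Tagged free_lie (lie_gen x).

Fixpoint psi_word (t : seq V) : symL :=
  if t is x :: t' then euler_act (lie_letter x) (psi_word t') else sword [::].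

Definition psi : tensor V -> symL := tensor_lift psi_word.

Lemma lie_gen_lin a (x y : V) : lie_gen (a *: x + y) = a *: lie_gen x + lie_gen y.
Proof. by apply: val_inj; rewrite /= tword1_linear. Qed.

Lemma psi_ml : multilinear psi_word.
Proof.
move=> s1 s2 a x y; elim: s1 => [|z s1 IH] /=; last by rewrite IH linearP.
by rewrite /lie_letter lie_gen_lin euler_act_linl.
Qed.

Fact psi_linear : linear psi.
Proof. exact: tensor_lift_linear psi_ml. Qed.
HB.instance Definition _ :=
  GRing.isLinear.Build K (tensor V) symL _ psi psi_linear.

Lemma psi_nil : psi (tword [::]) = sword [::].
Proof. exact: (tensor_lift_word _ psi_ml). Qed.

Lemma psi_letter (x : V) t : psi (tmul (tword [:: x]) t) = euler_act (lie_letter x) (psi t).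
Proof.
move: t; apply: tensor_ext => [||t]; [lin|lin|].
by rewrite tmul_word /psi !(tensor_lift_word _ psi_ml).
Qed.

(** Left multiplication and [euler_act] both represent the free Lie algebra, and [psi] intertwines
    them on letters by construction, hence on all brackets. *)
Lemma psi_lie_elt n (t : tensor V) : lie_elt n t ->
  forall t', psi (tmul t t') = euler_act (lie_homog n t) (psi t').
Proof.
elim=> [x|{}n|{}n a {}t t2 ht IH ht2 IH2|m {}n {}t t2 ht IH ht2 IH2] t'.
- by rewrite psi_letter -[lie_letter x](lie_homog_val (erefl (tag (lie_letter x)))).
- rewrite tmul0l linear0 lie_homog0.
  have := euler_act_linl (-1) (0 : free_lie n) 0 (psi t').
  by rewrite scaler0 addr0 scaleN1r addNr.
- by rewrite tmulDl tmulZl linearP /= IH IH2 lie_homogP // euler_act_linl.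
- have -> : lie_homog (m + n) (tmul t t2 - ksign (m * n) *: tmul t2 t) =
      bracket (lie_homog m t) (lie_homog n t2).
    rewrite -[RHS](@lie_homog_val _ _ (m + n)) //; congr lie_homog.
    by rewrite bracketE !lie_homogE.
  rewrite euler_act_bracket -!IH -!IH2 -!IH !tmulE -!tmulA.
  by rewrite linearB linearZ.
Qed.

Lemma psi_lie x t : psi (tmul (lie_val_of x) t) = euler_act x (psi t).
Proof. by rewrite (psi_lie_elt (lie_val_elt x)) lie_homog_val. Qed.

Lemma psi_val x : psi (lie_val_of x) = sword [:: x].
Proof.
by rewrite -[lie_val_of x]tmul1r psi_lie psi_nil /euler_act delta_nil addr0 sym_cons_sword.
Qed.

End EulerAction.

(** * The inverse [theta] of [psi] *)

Section Theta.
Variables (K : fieldType) (V : lmodType K).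
Hypothesis charK : [pchar K] =i pred0.

Local Notation free_lie := (free_lie V).
Local Notation homogL := (homog free_lie).
Local Notation symL := (sym free_lie).
Implicit Types (x y z : homogL) (u v w : symL) (s : seq homogL).

(** [theta] truncated to words of length less than [n]: as [delta x] preserves
    the length but replaces words by sums, the recursion is on a bound. *)
Fixpoint theta_trunc (n : nat) s : tensor V :=
  match n, s with
  | 0, _ => 0
  | _.+1, [::] => tword [::]
  | n'.+1, x :: s' => tmul (lie_val_of x) (sym_lift (theta_trunc n') (sword s'))
                      - sym_lift (theta_trunc n') (delta x (sword s'))
  end.

Local Notation theta_n n := (sym_lift (theta_trunc n)).

Lemma theta_trunc_cons n x u : sym_compat (theta_trunc n) ->
    sym_compat (theta_trunc n.+1) ->
  theta_n n.+1 (sym_cons x u) =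
  tmul (lie_val_of x) (theta_n n u) - theta_n n (delta x u).
Proof.
move=> /sym_lift_linear l1 c2; have l2 := sym_lift_linear c2.
move: u; apply: sym_ext => [||s]; [lin|lin|].
by rewrite sym_cons_sword (sym_lift_sword c2).
Qed.

Lemma lie_val_of_lin n a (y z : free_lie n) :
  lie_val_of (Tagged free_lie (a *: y + z)) =
  a *: lie_val_of (Tagged free_lie y) + lie_val_of (Tagged free_lie z).
Proof. by []. Qed.

Lemma theta_trunc_compat n : sym_compat (theta_trunc n).
Proof.
have [swl swc] := sword_compat free_lie.
(* Two consecutive bounds are treated together, because exchanging the first two letters unfolds the
   recursion twice. *)
suff [] : sym_compat (theta_trunc n) /\ sym_compat (theta_trunc n.+1) by [].
have c0 : sym_compat (theta_trunc 0) by split=> *; rewrite /= ?scaler0 ?addr0.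
elim: n => [|n [c1 c2]]; split=> //.
  (* Bound 0 gives 0, so bound 1 vanishes on nonempty words, the only ones in the relations. *)
  have z u : theta_n 0 u = 0.
    elim/sym_ind: u => [|a s u IH]; first by rewrite (lin0 (sym_lift_linear c0)).
    by rewrite (sym_lift_linear c0) IH (sym_lift_sword c0) scaler0 addr0.
  by split=> [[|? s1]|[|? s1]] *; rewrite /= !z !tmulE !subrr ?scaler0 ?addr0.
have l1 := sym_lift_linear c1; have l2 := sym_lift_linear c2.
split=> [[|x s1] s2 m a y z|[|x s1] s2 y z].
- rewrite [LHS]/= [theta_trunc]lock /= -lock lie_val_of_lin delta_linl l2 !tmulE; modring.
- rewrite [LHS]/= [theta_trunc]lock /= -lock swl (delta_linear x) !l2 !tmulE; modring.
- rewrite !cat0s.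
  (* Two steps of the recursion; [delta x'] applied to [y' s2] produces the Euler bracket. *)
  have E x' y' : theta_trunc n.+2 (x' :: y' :: s2) =
      tmul (tmul (lie_val_of x') (lie_val_of y')) (theta_n n (sword s2))
      - tmul (lie_val_of x') (theta_n n (delta y' (sword s2)))
      - theta_n n.+1 (sym_cons (euler_bracket x' y') (sword s2))
      - ksign (tag x' * tag y') *: (tmul (lie_val_of y') (theta_n n (delta x' (sword s2)))
        - theta_n n (delta y' (delta x' (sword s2)))).
    rewrite -[LHS]/(tmul _ (theta_n n.+1 (sword (y' :: s2)))
       - theta_n n.+1 (delta x' (sword (y' :: s2)))).
    rewrite -sym_cons_sword delta_cons (linD l2) (linZ l2) !theta_trunc_cons //.
    by rewrite !tmulE !tmulA; modring.
  (* The recursion for [bracket y z], expanded by [sym_cons_bracket] and [delta_bracket], says that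
     the expansions of [y z s2] and of [z y s2], the latter with its Koszul sign, have difference
     0. *)
  have := theta_trunc_cons (bracket y z) (sword s2) c1 c2.
  rewrite (sym_cons_bracket charK) (delta_bracket charK) bracketE /tbracket.
  rewrite !(linD l2, linN l2, linZ l2, linD l1, linN l1, linZ l1) !tmulE !E.
  rewrite (mulrC (tag z)); move/eqP; rewrite -subr_eq0 => /eqP e.
  apply/eqP; rewrite -subr_eq0; apply/eqP; rewrite -[RHS]oppr0 -e.
  by case: (ksignP K (tag y * tag z)) => ->; modring.
- rewrite [LHS]/= [theta_trunc]lock /= -lock swc (linZ (delta_linear x)) !(linZ l2) !tmulE; modring.
Qed.

Definition theta_word s : tensor V := theta_trunc (size s).+1 s.

Definition theta : symL -> tensor V := sym_lift theta_word.

Lemma theta_compat : sym_compat theta_word.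
Proof.
split=> [s1 s2 n a x y|s1 s2 x y]; rewrite /theta_word !size_cat.
  exact: (theta_trunc_compat _).1.
exact: (theta_trunc_compat _).2.
Qed.

Lemma theta_linear : linear theta.
Proof. exact: sym_lift_linear theta_compat. Qed.

Lemma delta_length x k u : sym_length k u -> sym_length k (delta x u).
Proof. exact: (sym_der_length (tag_euler x) (@euler_bracket_linr _ _ x)). Qed.

(** One bound serves all words of a given length, hence also sums of them such as [delta x u]. *)
Lemma theta_length k u : sym_length k u -> theta u = theta_n k.+1 u.
Proof.
have l i := sym_lift_linear (theta_trunc_compat i).
elim=> [|a _ v [s <- ->] _ IHv]; first by rewrite (lin0 theta_linear) (lin0 (l _)).
rewrite theta_linear l IHv /theta (sym_lift_sword theta_compat).
by rewrite (sym_lift_sword (theta_trunc_compat _)).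
Qed.

Lemma theta_nil : theta (sword [::]) = tword [::].
Proof. by rewrite /theta (sym_lift_sword theta_compat). Qed.

Lemma theta_cons x u :
  theta (sym_cons x u) = tmul (lie_val_of x) (theta u) - theta (delta x u).
Proof.
have tl := theta_linear.
move: u; apply: sym_ext => [||s]; [lin|lin|].
rewrite sym_cons_sword {1}/theta (sym_lift_sword theta_compat) /theta_word /=.
rewrite -!theta_length //; last exact: sym_length_sword.
exact/delta_length/sym_length_sword.
Qed.

(** Induction on the length: in [psi] of the recursion for [theta], the two terms in [delta x]
    cancel, as [delta x] preserves the length. *)
Lemma thetaK : cancel theta (@psi K V).
Proof.
have tl := theta_linear.
apply: sym_ext => [||s]; [lin|lin|].
suff h k u : sym_length k u -> psi (theta u) = u by exact: h (sym_length_sword s).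
elim: k u => [|k IH] u; elim=> [|a _ v [{}s e ->] _ IHv].
- by rewrite (lin0 tl) linear0.
- by case: s e => // _; rewrite tl linearP /= IHv theta_nil psi_nil.
- by rewrite (lin0 tl) linear0.
rewrite tl linearP /= IHv; congr (_ *: _ + _); case: s e => // x s [e].
have es : sym_length k (sword s) by rewrite -e; apply: sym_length_sword.
rewrite -sym_cons_sword theta_cons linearB /= (psi_lie charK) IH //.
by rewrite IH ?addrK //; apply: delta_length.
Qed.

(** The recursion for [theta] says that it turns [euler_act x] back into left multiplication by
    [x]. *)
Lemma psiK : cancel (@psi K V) theta.
Proof.
have tl := theta_linear.
apply: tensor_ext => [||t]; [lin|lin|].
elim: t => [|x t IH]; first by rewrite psi_nil theta_nil.
by rewrite tword_cons psi_letter (linD tl) theta_cons subrK IH.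
Qed.

End Theta.

(** * Degrees and signs under [psi] and [theta] *)

Section PsiDegree.
Variables (K : fieldType) (V : lmodType K).
Hypothesis charK : [pchar K] =i pred0.

Local Notation free_lie := (free_lie V).
Local Notation homogL := (homog free_lie).
Local Notation symL := (sym free_lie).
Implicit Types (x y z : homogL) (u v w : symL) (s : seq homogL).

Lemma delta_degree x m u : sym_degree m u -> sym_degree (tag x + m) (delta x u).
Proof. exact: (sym_der_degree (tag_euler x) (@euler_bracket_linr _ _ x)). Qed.

Lemma psi_degree m (t : tensor V) : tensor_degree m t -> sym_degree m (psi t).
Proof.
elim=> [|a _ v [s <- ->] _ IH]; first by rewrite linear0; apply: lspan0.
rewrite linearP; apply/lspanD/IH/lspanZ; elim: s {IH} => [|x s IH] /=.
  by rewrite psi_nil; apply: lspan_mem; exists [::] => //; rewrite /hdeg big_nil.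
rewrite tword_cons psi_letter -add1n PoszD; apply: lspanD.
  exact: (sym_degree_cons (lie_letter x)).
exact: (delta_degree (lie_letter x)).
Qed.

Lemma theta_degree m u : sym_degree m u -> tensor_degree m (theta u).
Proof.
have l n := sym_lift_linear (@theta_trunc_compat _ V charK n).
have tl := @theta_linear _ V charK.
(* The degree is followed through every truncation, by induction on the bound. *)
have h n m' u' : sym_degree m' u' -> tensor_degree m' (sym_lift (theta_trunc n) u').
  elim: n m' u' => [|n IH] m' u'; elim=> [|a _ v [s <- ->] _ IHv];
    try by rewrite (lin0 (l _)); apply: lspan0.
    rewrite l; apply/lspanD/IHv/lspanZ.
    by rewrite (sym_lift_sword (theta_trunc_compat V charK _)); apply: lspan0.
  rewrite l; apply/lspanD/IHv/lspanZ; case: s {IHv} => [|x s].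
    rewrite (sym_lift_sword (theta_trunc_compat V charK _)) /hdeg big_nil.
    exact: (tensor_degree_word [::]).
  have hs := sym_degree_sword s.
  rewrite -sym_cons_sword theta_trunc_cons //; do ?exact: theta_trunc_compat.
  rewrite hdeg_cons; apply: lspanD; last by apply/lspanN/IH/delta_degree.
  by apply: tensor_degreeM; [apply/lie_elt_degree/lie_val_elt|apply: IH].
elim=> [|a _ v [s <- ->] _ IHv]; first by rewrite (lin0 tl); apply: lspan0.
rewrite tl; apply/lspanD/IHv/lspanZ.
rewrite (theta_length charK (sym_length_sword s)).
exact/h/sym_degree_sword.
Qed.

Lemma sym_sign_degree p m u : sym_degree m u -> sym_sign p u = ksign (p * m) *: u.
Proof.
elim=> [|a _ v [s <- ->] _ IH]; first by rewrite linear0 scaler0.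
by rewrite linearP /= IH sym_sign_sword scalerDr !scalerA mulrC.
Qed.

Lemma psi_sign p (t : tensor V) : psi (tsign p t) = sym_sign p (psi t).
Proof.
move: t; apply: tensor_ext => [||s]; [lin|lin|].
rewrite (sym_sign_degree _ (psi_degree (tensor_degree_word s))).
by rewrite tsign_word linearZ.
Qed.

End PsiDegree.

(** * Compatibility of [psi] with the coproducts *)

Section TensorCoproduct.
Variables (K : fieldType) (V : lmodType K).
Local Notation T := (tensor V).

(** Left multiplication by [x \otimes 1 + 1 \otimes x] on the graded algebra
    [T \otimes T], and right multiplication below. *)
Definition tcomult_step (x : V) (t : tens T T) : tens T T :=
  tens_map (tmul (tword [:: x])) id t + tens_map (tsign 1) (tmul (tword [:: x])) t.

Definition tcomult_rstep (x : V) (t : tens T T) : tens T T :=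
  tens_map id (fun u => tmul u (tword [:: x])) t
  + tens_map (fun u => tmul u (tword [:: x])) (tsign 1) t.

Fact tcomult_step_linear x : linear (tcomult_step x).
Proof. by rewrite /tcomult_step; lin. Qed.
HB.instance Definition _ x :=
  GRing.isLinear.Build K _ _ _ (tcomult_step x) (tcomult_step_linear x).

Fact tcomult_rstep_linear x : linear (tcomult_rstep x).
Proof. by rewrite /tcomult_rstep; lin. Qed.
HB.instance Definition _ x :=
  GRing.isLinear.Build K _ _ _ (tcomult_rstep x) (tcomult_rstep_linear x).

Lemma tcomult_step_pure x u v : tcomult_step x (pure u v) =
  pure (tmul (tword [:: x]) u) v + pure (tsign 1 u) (tmul (tword [:: x]) v).
Proof. by rewrite /tcomult_step !tens_map_pure; do ?lin. Qed.

Lemma tcomult_rstep_pure x u v : tcomult_rstep x (pure u v) =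
  pure u (tmul v (tword [:: x])) + pure (tmul u (tword [:: x])) (tsign 1 v).
Proof. by rewrite /tcomult_rstep !tens_map_pure; do ?lin. Qed.

(** The coproduct for which the letters are primitive. *)
Definition tcomult : T -> tens T T :=
  tensor_lift (foldr tcomult_step (pure (tword [::]) (tword [::]))).

Lemma tcomult_ml : multilinear (foldr tcomult_step (pure (tword [::]) (tword [::]))).
Proof.
move=> s1 s2 a x y; elim: s1 => [|z s1 IH] /=; last by rewrite IH linearP.
move: (foldr _ _ s2); apply: tens_ext => [||u v]; [lin|lin|].
by rewrite !tcomult_step_pure tword1_linear !tmulE !pureE; modring.
Qed.

Fact tcomult_linear : linear tcomult.
Proof. exact: tensor_lift_linear tcomult_ml. Qed.
HB.instance Definition _ := GRing.isLinear.Build K _ _ _ tcomult tcomult_linear.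

Lemma tcomult_nil : tcomult (tword [::]) = pure (tword [::]) (tword [::]).
Proof. exact: (tensor_lift_word _ tcomult_ml). Qed.

Lemma tcomult_letter x u : tcomult (tmul (tword [:: x]) u) = tcomult_step x (tcomult u).
Proof.
move: u; apply: tensor_ext => [||t]; [lin|lin|].
by rewrite tmul_word /tcomult !(tensor_lift_word _ tcomult_ml).
Qed.

Lemma tsign_letter p (x : V) : tsign p (tword [:: x]) = ksign p *: tword [:: x].
Proof. by rewrite tsign_word mulr1. Qed.

(** The coproduct is built from the first letter, whereas [dLeib] is computed from the last. Left
    and right multiplications commute, which carries the rule from one end to the other. *)
Lemma tcomult_rletter x u : tcomult (tmul u (tword [:: x])) = tcomult_rstep x (tcomult u).
Proof.
move: u; apply: tensor_ext => [||s]; [lin|lin|].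
elim: s => [|y s IH].
  rewrite tmul1l tcomult_nil -[tword [:: x]]tmul1r tcomult_letter tcomult_nil.
  rewrite tcomult_step_pure tcomult_rstep_pure !tmul1r !tmul1l tsign_word.
  by rewrite mulr0 /ksign expr0z scale1r addrC.
rewrite tword_cons -tmulA !tcomult_letter IH; move: (tcomult _).
apply: tens_ext => [||u v]; [lin|lin|].
rewrite tcomult_rstep_pure tcomult_step_pure !linearD /=.
rewrite !tcomult_rstep_pure !tcomult_step_pure !tsignM !tsign_letter !tmulE !tmulA.
by rewrite !pureE /ksign expr1z; modring.
Qed.

Lemma tcomult_sign p u : tcomult (tsign p u) = tens_map (tsign p) (tsign p) (tcomult u).
Proof.
move: u; apply: tensor_ext => [||s]; [lin|lin|].
elim: s => [|y s IH].
  rewrite tsign_word linearZ /= tcomult_nil tens_map_pure; do ?lin.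
  by rewrite !tsign_word mulr0 /ksign expr0z !scale1r.
rewrite tword_cons tsignM tsign_letter tmulE linearZ /= !tcomult_letter IH.
move: (tcomult _); apply: tens_ext => [||u v]; [lin|lin|].
rewrite tens_map_pure; do ?lin.
rewrite !tcomult_step_pure (linD (tens_map_linear (tsign_linear p) (tsign_linear p))).
rewrite !tens_map_pure; do ?lin.
have e : tsign p (tsign 1 u) = tsign 1 (tsign p u).
  move: u; apply: tensor_ext => [||t]; [lin|lin|].
  by rewrite !(tsign_word, linearZ) /= !tsign_word !scalerA mulrC.
by rewrite !tsignM !tsign_letter e !tmulE !pureE; modring.
Qed.

Hypothesis charK : [pchar K] =i pred0.

(** For a letter, [euler_act] is a product with a primitive element plus a coderivation of the same
    degree, so it obeys the coproduct rule of left multiplication by that letter. *)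
Lemma comult_psi u : comult (psi u) = tens_map (@psi K V) (@psi K V) (tcomult u).
Proof.
move: u; apply: tensor_ext => [||s]; [lin|lin|].
elim: s => [|x s IH].
  by rewrite psi_nil comult_nil tcomult_nil tens_map_pure ?psi_nil //; lin.
rewrite tword_cons psi_letter tcomult_letter linearD /= comult_cons.
rewrite (comult_der (tag_euler _) (@euler_bracket_linr _ _ _)) IH.
rewrite -[sym_der _ _]/(delta (lie_letter x)).
move: (tcomult _); apply: tens_ext => [||a b]; [lin|lin|].
rewrite !tens_map_pure; do ?lin.
rewrite comult_step_pure tcomult_step_pure.
rewrite (linD (tens_map_linear (@psi_linear K V) (@psi_linear K V))).
rewrite !tens_map_pure; do ?lin.
rewrite !psi_letter psi_sign /euler_act !pureE -[tag _]/(1 : int); modring.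
Qed.

End TensorCoproduct.

(** * Naturality of [psi] *)

Section PsiFunctor.
Variables (K : fieldType) (V V' : lmodType K) (f : {linear V -> V'}).

Definition lie_homog_map (x : homog (free_lie V)) : homog (free_lie V') :=
  Tagged (free_lie V') (lie_map f (tagged x)).

Local Notation symf :=
  (sym_map (V := free_lie V) (V' := free_lie V') (fun n => @lie_map K V V' f n)).

Let mapl n : linear (@lie_map K V V' f n : free_lie V n -> free_lie V' n).
Proof. exact: lie_map_linear. Qed.

Lemma sym_map_cons x u : symf (sym_cons x u) = sym_cons (lie_homog_map x) (symf u).
Proof.
have sl := sym_map_linear mapl.
move: u; apply: sym_ext => [||s]; [lin|lin|].
by rewrite sym_cons_sword !(sym_map_sword mapl) sym_cons_sword.
Qed.

Lemma lie_homog_map_euler x y : lie_homog_map (euler_bracket x y) =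
  euler_bracket (lie_homog_map x) (lie_homog_map y).
Proof.
congr (Tagged _ _); apply: val_inj => /=.
by rewrite linearZ /= /tbracket linearB linearZ /= !tensor_mapM.
Qed.

Lemma sym_map_delta x u : symf (delta x u) = delta (lie_homog_map x) (symf u).
Proof.
have sl := sym_map_linear mapl.
move: u; apply: sym_ext => [||s]; [lin|lin|].
elim: s => [|y s IH]; first by rewrite delta_nil (lin0 sl) (sym_map_sword mapl) delta_nil.
rewrite -sym_cons_sword delta_cons (linD sl) (linZ sl) !sym_map_cons IH.
by rewrite delta_cons lie_homog_map_euler.
Qed.

Lemma sym_map_psi t : symf (psi t) = psi (tensor_map f t).
Proof.
have sl := sym_map_linear mapl.
move: t; apply: tensor_ext => [||s]; [lin|lin|].
elim: s => [|x s IH]; first by rewrite tensor_map_word !psi_nil (sym_map_sword mapl).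
rewrite tword_cons psi_letter tensor_mapM [tensor_map f (tword [:: x])]tensor_map_word.
rewrite psi_letter -IH (linD sl) sym_map_cons sym_map_delta /euler_act.
suff -> : lie_homog_map (lie_letter x) = lie_letter (f x) by [].
by congr (Tagged _ _); apply: val_inj; rewrite /= tensor_map_word.
Qed.

End PsiFunctor.

(** * The Leibniz differential *)

Section LeibnizDifferential.
Variables (K : fieldType) (g : leibnizType K).
Local Notation T := (tensor g).
Implicit Types (x y z : g) (s t : seq g) (u v w : T).

Fixpoint rho_word x s : T :=
  if s is y :: s' then tword (leib y x :: s') + tmul (tword [:: y]) (rho_word x s')
  else 0.

Definition rho x : T -> T := tensor_lift (rho_word x).

Lemma rho_ml x : multilinear (rho_word x).
Proof.
move=> s1 s2 a y z; elim: s1 => [|w s1 IH] /=.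
  rewrite leib_linearl !(tword_cons _ s2) !tword1_linear !tmulE; modring.
by rewrite -!(cat_cons (leib w x)) tword_lin IH !tmulE; modring.
Qed.

Fact rho_linear x : linear (rho x).
Proof. exact: tensor_lift_linear (rho_ml x). Qed.
HB.instance Definition _ x := GRing.isLinear.Build K T T _ (rho x) (rho_linear x).

Lemma rho_letter x y : rho x (tword [:: y]) = tword [:: leib y x].
Proof. by rewrite /rho (tensor_lift_word _ (rho_ml x)) /= tmul0r addr0. Qed.

Lemma rho_nil x : rho x (tword [::]) = 0.
Proof. by rewrite /rho (tensor_lift_word _ (rho_ml x)). Qed.

Lemma rhoM x u v : rho x (tmul u v) = tmul (rho x u) v + tmul u (rho x v).
Proof.
move: u; apply: tensor_ext => [||s]; [lin|lin|].
move: v; apply: tensor_ext => [||t]; [lin|lin|].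
rewrite tmul_word /rho !(tensor_lift_word _ (rho_ml x)).
elim: s => [|y s IH] /=; first by rewrite tmul0l tmul1l add0r.
by rewrite IH -cat_cons -tmul_word (tword_cons y s) tmulDl tmulDr !tmulA addrA.
Qed.

Lemma rho_sign p x u : tsign p (rho x u) = rho x (tsign p u).
Proof.
move: u; apply: tensor_ext => [||s]; [lin|lin|].
elim: s => [|y s IH]; first by rewrite tsign_word linearZ /= rho_nil linear0 scaler0.
rewrite tword_cons rhoM linearD /= !tsignM IH rhoM.
by rewrite !tsign_letter linearZ /= !rho_letter tsign_letter.
Qed.

Lemma tmul_sumr (I : Type) (r : seq I) (P : pred I) (F : I -> T) u :
  tmul u (\sum_(i <- r | P i) F i) = \sum_(i <- r | P i) tmul u (F i).
Proof. by apply: (big_morph (tmul u)) => [v w|]; rewrite ?tmul0r ?tmulDr. Qed.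

Lemma tmul_suml (I : Type) (r : seq I) (P : pred I) (F : I -> T) u :
  tmul (\sum_(i <- r | P i) F i) u = \sum_(i <- r | P i) tmul (F i) u.
Proof. by apply: (big_morph (fun v => tmul v u)) => [v w|]; rewrite ?tmul0l ?tmulDl. Qed.

(** The shape in which the terms of [dLeib_word] that remove the last letter appear. *)
Lemma rho_sum x s : rho x (tword s) =
  \sum_(i < size s) tword [seq if l == i :> nat then leib s`_l x else s`_l | l <- iota 0 (size s)].
Proof.
rewrite /rho (tensor_lift_word _ (rho_ml x)); elim: s => [|y s IH] /=; first by rewrite big_ord0.
have e (h : nat -> g) : [seq h l | l <- iota 1 (size s)] = [seq h l.+1 | l <- iota 0 (size s)].
  by rewrite (iotaDl 1 0) -map_comp.
rewrite big_ord_recl /= e /=; congr (_ + _).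
  by congr (tword (_ :: _)); rewrite -[LHS](mkseq_nth 0).
rewrite IH tmul_sumr; apply: eq_bigr => i _; rewrite tmul_word /= e.
by congr (tword (_ :: _)); apply/eq_map.
Qed.

(** The terms that remove the last letter [x] make up [rho x], with sign given by the length of [u];
    in all others [x] stays at the end. *)
Lemma dLeib_rletter x u :
  dLeib (tmul u (tword [:: x])) = tmul (dLeib u) (tword [:: x]) + rho x (tsign 1 u).
Proof.
move: u; apply: tensor_ext => [||s]; [lin|lin|].
rewrite -tword_rcons tsign_word linearZ /= !dLeib_tword /dLeib_word size_rcons.
have nthr l : (l < size s)%N -> (rcons s x)`_l = s`_l by move=> h; rewrite nth_rcons h.
have nthx : (rcons s x)`_(size s) = x by rewrite nth_rcons ltnn eqxx.
have iotar : iota 0 (size s).+1 = rcons (iota 0 (size s)) (size s).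
  by rewrite -addn1 iotaD cats1.
(* Splits off the index [j = size s], the position of [x]. *)
rewrite big_ord_recr /= tmul_suml; congr (_ + _).
  apply: eq_bigr => j _; rewrite tmul_suml; apply: eq_bigr => i _.
  rewrite tmulZl -tword_rcons; congr (_ *: tword _).
  rewrite /leib_contract size_rcons iotar filter_rcons gtn_eqF // map_rcons.
  rewrite gtn_eqF; last exact: ltn_trans (ltn_ord i) (ltn_ord j).
  rewrite nthx; congr (rcons _ x); apply/eq_in_map => l.
  rewrite mem_filter mem_iota => /andP[_ /andP[_ lts]].
  by rewrite !nthr // (ltn_trans (ltn_ord i)).
rewrite rho_sum scaler_sumr; apply: eq_bigr => i _.
rewrite mul1r; congr (_ *: tword _).
rewrite /leib_contract size_rcons iotar filter_rcons eqxx /=.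
rewrite (eq_in_filter (a2 := predT)) ?filter_predT; last first.
  by move=> l; rewrite mem_iota add0n => h; rewrite ltn_eqF.
apply/eq_in_map => l; rewrite mem_iota => /andP[_ lts]; rewrite nthx.
by case: eqP => [<-|_]; rewrite !nthr.
Qed.

Lemma dLeib_nil : dLeib (tword [::]) = 0 :> T.
Proof. by rewrite dLeib_tword /dLeib_word big_ord0. Qed.

Lemma dLeib_letter x : dLeib (tword [:: x]) = 0 :> T.
Proof.
rewrite -[tword [:: x]]tmul1l dLeib_rletter dLeib_nil tsign_word mulr0 linearZ /=.
by rewrite rho_nil !tmulE scaler0 addr0.
Qed.

Lemma tensor_degree_rho x n u : tensor_degree n u -> tensor_degree n (rho x u).
Proof.
elim=> [|a _ v [s <- ->] _ IH]; first by rewrite linear0; apply: lspan0.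
rewrite linearP /=; apply/lspanD/IH/lspanZ; elim: s {IH} => [|y s IH].
  by rewrite rho_nil; apply: lspan0.
rewrite tword_cons rhoM rho_letter /= -add1n PoszD tmul_word; apply: lspanD.
  exact: (tensor_degree_word (_ :: _)).
by apply: tensor_degreeM => //; apply: (tensor_degree_word [:: y]).
Qed.

Lemma dLeib_degree n u : tensor_degree n u -> tensor_degree (n - 1) (dLeib u).
Proof.
elim=> [|a _ v [s <- ->] _ IH]; first by rewrite linear0; apply: lspan0.
rewrite linearP /=; apply/lspanD/IH/lspanZ; elim/last_ind: s {IH} => [|s y IH].
  by rewrite dLeib_nil; apply: lspan0.
rewrite tword_rcons dLeib_rletter tsign_word linearZ size_rcons -addn1 PoszD addrK.
apply: lspanD; last by apply/lspanZ/tensor_degree_rho/tensor_degree_word.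
rewrite -[size s : int](subrK 1); apply: tensor_degreeM => //.
exact: (tensor_degree_word [:: y]).
Qed.

Lemma dLeib_sign p u : tsign p (dLeib u) = ksign p *: dLeib (tsign p u).
Proof.
move: u; apply: tensor_ext => [||s]; [lin|lin|].
rewrite (tsign_degree _ (dLeib_degree (tensor_degree_word s))) tsign_word linearZ /= scalerA.
by rewrite mulrBr mulr1 ksignD ksignN mulrC.
Qed.

(** Right multiplication by [x] is a derivation of the Leibniz algebra, so the induced [rho x]
    commutes with the differential. *)
Lemma dLeib_rho x u : dLeib (rho x u) = rho x (dLeib u).
Proof.
move: u; apply: tensor_ext => [||s]; [lin|lin|].
elim/last_ind: s => [|s y IH]; first by rewrite rho_nil dLeib_nil !linear0.
rewrite tword_rcons rhoM linearD /= rho_letter !dLeib_rletter linearD /= rhoM rho_letter IH.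
rewrite !rho_sign.
(* Both sides are derivations; on a letter [z] this is [z (y x) = (z y) x - (z x) y], the Leibniz
   identity. *)
have -> : rho (leib y x) (tsign 1 (tword s)) =
    rho x (rho y (tsign 1 (tword s))) - rho y (rho x (tsign 1 (tword s))); last by modring.
move: (tsign _ _) => u; move: u {IH}; apply: tensor_ext => [||t]; [lin|lin|].
elim: t => [|z t IH]; first by rewrite !rho_nil !(lin0 (rho_linear _)) subrr.
rewrite tword_cons !(rhoM, linearD) /= !(rhoM, rho_letter) IH leibE.
rewrite (linD (@tword1_linear _ _)) (linN (@tword1_linear _ _)) !tmulE; modring.
Qed.

(** Induction on the last letter: two terms in [rho] remain, and they cancel because [dLeib]
    commutes with [rho] and anticommutes with [tsign 1]. *)
Lemma dLeib_sq u : dLeib (dLeib u) = 0.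
Proof.
move: u; apply: tensor_ext => [||s]; [lin|by move=> a v w; rewrite scaler0 addr0|].
elim/last_ind: s => [|s y IH]; first by rewrite dLeib_nil linear0.
rewrite tword_rcons dLeib_rletter linearD /= dLeib_rletter IH dLeib_rho dLeib_sign.
by rewrite linearZ /= tmul0l add0r /ksign expr1z scaleN1r addNr.
Qed.

Lemma tcomult_rho x u : tcomult (rho x u) =
  tens_map (rho x) id (tcomult u) + tens_map id (rho x) (tcomult u).
Proof.
move: u; apply: tensor_ext => [||s]; [lin|lin|].
elim: s => [|y s IH].
  by rewrite rho_nil linear0 tcomult_nil !tens_map_pure ?rho_nil ?pureE ?addr0 //; lin.
rewrite tword_cons rhoM rho_letter linearD /= !tcomult_letter IH.
move: (tcomult _); apply: tens_ext => [||a b]; [lin|lin|].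
rewrite !tens_map_pure; do ?lin.
rewrite (linD (tcomult_step_linear y)) !tcomult_step_pure.
rewrite (linD (tens_map_linear (rho_linear x) (@lin_id _ _))).
rewrite (linD (tens_map_linear (@lin_id _ _) (rho_linear x))).
rewrite !tens_map_pure; do ?lin.
by rewrite !rhoM !rho_letter rho_sign !pureE; modring.
Qed.

(** Induction on the last letter [x], which is primitive; the extra term is harmless because [rho x]
    is a coderivation by [tcomult_rho]. *)
Lemma tcomult_dLeib u : tcomult (dLeib u) =
  tens_map (@dLeib K g) id (tcomult u) + tens_map (tsign (-1)) (@dLeib K g) (tcomult u).
Proof.
(* The signs for [p] and [-p] agree, and [tcomult_rstep] uses [tsign 1]. *)
have -> : tens_map (tsign (-1)) (@dLeib K g) (tcomult u) =
    tens_map (tsign 1) (@dLeib K g) (tcomult u).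
  congr (tens_map _ _ _); apply/funext; apply: tensor_ext => [||s]; [lin|lin|].
  by rewrite !tsign_word mulN1r mul1r ksignN.
move: u; apply: tensor_ext => [||s]; [lin|lin|].
elim/last_ind: s => [|s x IH].
  by rewrite dLeib_nil linear0 tcomult_nil !tens_map_pure ?dLeib_nil ?pureE ?addr0 //; lin.
rewrite tword_rcons dLeib_rletter linearD /= !tcomult_rletter IH tcomult_rho tcomult_sign.
move: (tcomult _); apply: tens_ext => [||a b]; [lin|lin|].
rewrite !tens_map_pure; do ?lin.
rewrite (linD (tcomult_rstep_linear x)) !tcomult_rstep_pure.
rewrite (linD (tens_map_linear (@dLeib_linear K g) (@lin_id _ _))).
rewrite (linD (tens_map_linear (tsign_linear 1) (@dLeib_linear K g))).
rewrite !tens_map_pure; do ?lin.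
rewrite !dLeib_rletter !tsignM !tsign_letter dLeib_sign !tmulE !pureE /ksign expr1z.
modring.
Qed.

End LeibnizDifferential.

(** * Stability of the Lie elements under the differential *)

Section DifferentialOnLie.
Variables (K : fieldType) (g : leibnizType K).
Local Notation T := (tensor g).
Implicit Types (x y z : g) (s t : seq g) (u v w : T).

Lemma rho_lie x n u : lie_elt n u -> lie_elt n (rho x u).
Proof.
elim=> [y|{}n|{}n a {}u v _ hu _ hv|m {}n {}u v hu hu' hv hv'].
- by rewrite rho_letter; apply: lie_elt_gen.
- by rewrite linear0; apply: lie_elt0.
- by rewrite linearP; apply: lie_eltP.
have -> : rho x (tmul u v - ksign (m * n) *: tmul v u) =
    1 *: tbracket m n (rho x u) v + tbracket m n u (rho x v).
  by rewrite linearB linearZ /= !rhoM /tbracket; modring.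
by apply: lie_eltP; apply: lie_elt_bracket.
Qed.

(** Letters do not have this property, but brackets do: the terms in [rho]
    cancel. *)
Definition right_leibniz u : Prop :=
  forall w, dLeib (tmul w u) = tmul (dLeib w) u + tmul (tsign 1 w) (dLeib u).

Lemma right_leibnizM u v :
  right_leibniz u -> right_leibniz v -> right_leibniz (tmul u v).
Proof.
by move=> hu hv w; rewrite tmulA !hv hu tsignM !tmulE !tmulA; modring.
Qed.

Lemma right_leibnizP a u v :
  right_leibniz u -> right_leibniz v -> right_leibniz (a *: u + v).
Proof. by move=> hu hv w; rewrite linearP /= !tmulE linearP /= hu hv; modring. Qed.

Lemma right_leibniz0 : right_leibniz 0.
Proof. by move=> w; rewrite tmul0r linear0 !tmul0r addr0. Qed.

Lemma dLeib_letters x y :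
  dLeib (tmul (tword [:: x]) (tword [:: y])) = - tword [:: leib x y].
Proof.
rewrite dLeib_rletter dLeib_letter tmul0l add0r tsign_letter.
by rewrite linearZ /= rho_letter /ksign expr1z scaleN1r.
Qed.

(** Up to a common sign, [w x y] contributes [rho x (w) y - rho y (w) x], which is antisymmetric in
    [x] and [y], while the bracket of two odd letters is [x y + y x]. *)
Lemma right_leibniz_letters x y :
  right_leibniz (tbracket 1 1 (tword [:: x]) (tword [:: y])).
Proof.
have dl := @dLeib_linear K g; have dlE := (linD dl, linN dl, linZ dl).
move=> w; rewrite /tbracket mul1r /ksign expr1z !tmulE !dlE !dLeib_letters.
rewrite !tmulA !dLeib_rletter !tsignM !tsign_letter.
rewrite !tmulE !(linZ (rho_linear _)) !rhoM !rho_letter ?tmulE /ksign expr1z.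
modring.
Qed.

(** The term [rho y v] comes from the product in which [y] stands to the right of [v]. *)
Lemma dLeib_bracket_letter y n v : lie_elt n v -> right_leibniz v ->
  dLeib (tbracket 1 n (tword [:: y]) v) =
  - tbracket 1 (n - 1) (tword [:: y]) (dLeib v) - rho y v.
Proof.
have dl := @dLeib_linear K g; have dlE := (linD dl, linN dl, linZ dl).
move=> hv lv; rewrite /tbracket !mul1r !dlE lv dLeib_rletter dLeib_letter.
rewrite tsign_letter (tsign_degree _ (lie_elt_degree hv)) mul1r (linZ (rho_linear y)).
rewrite !tmulE !ksignD ksignN ksign1.
by case: (ksignP K n) => ->; modring.
Qed.

Lemma right_leibniz_letter y n v : lie_elt n v -> right_leibniz v ->
  right_leibniz (tbracket 1 n (tword [:: y]) v).
Proof.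
have dl := @dLeib_linear K g; have dlE := (linD dl, linN dl, linZ dl).
move=> hv lv w; rewrite (dLeib_bracket_letter y hv lv) /tbracket !tmulE !tmulA.
rewrite !dlE !dLeib_rletter !lv !dLeib_rletter !tsignM.
rewrite (tsign_degree _ (lie_elt_degree hv)) !mul1r tsign_letter !ksignD ksignN ksign1.
rewrite !tmulE !(linZ (rho_linear _)) !rhoM ?tmulE ?tmulA.
by case: (ksignP K n) => ->; modring.
Qed.

Lemma dLeib_bracket m n u v : lie_elt m u -> lie_elt n v ->
    right_leibniz u -> right_leibniz v ->
  dLeib (tbracket m n u v) =
  tbracket (m - 1) n (dLeib u) v + ksign m *: tbracket m (n - 1) u (dLeib v).
Proof.
move=> hu hv lu lv; rewrite /tbracket linearB linearZ /= lv lu.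
rewrite (tsign_degree _ (lie_elt_degree hv)) (tsign_degree _ (lie_elt_degree hu)) !tmulE.
rewrite !mulrBr mulrBl !mulr1 !mul1r !ksignD !ksignN.
by case: (ksignP K (m * n)) => ->; case: (ksignP K m) => ->;
  case: (ksignP K n) => ->; modring.
Qed.

(** The two claims are proved together, since the formulas for [dLeib] of a bracket require
    [right_leibniz] of the factors. This fails for letters, hence the separate cases for factors of
    degree 1. *)
Lemma lie_elt_dLeib_gt1 n u : lie_elt n u -> n != 1 ->
  right_leibniz u /\ lie_elt (n - 1) (dLeib u).
Proof.
elim=> [x|{}n|{}n a {}u v _ hu _ hv|m {}n {}u v hu IHu hv IHv] n1 //.
- by rewrite linear0; split; [exact: right_leibniz0 | exact: lie_elt0].
- have [lu du] := hu n1; have [lv dv] := hv n1.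
  by rewrite linearP; split; [exact: right_leibnizP | exact: lie_eltP].
rewrite -/(tbracket m n u v).
have z : right_leibniz 0 /\ lie_elt (m + n - 1) (dLeib (0 : T)).
  by rewrite linear0; split; [exact: right_leibniz0 | exact: lie_elt0].
have [->|m0] := lie_elt_gt0 hu; first by rewrite tbracket0l.
have [->|n0] := lie_elt_gt0 hv; first by rewrite tbracket0r.
have letter (k : int) (y : g) (w : T) : lie_elt k w -> right_leibniz w ->
    lie_elt (k - 1) (dLeib w) ->
    right_leibniz (tbracket 1 k (tword [:: y]) w) /\
    lie_elt k (dLeib (tbracket 1 k (tword [:: y]) w)).
  move=> hw lw dw; split; first exact: right_leibniz_letter.
  rewrite dLeib_bracket_letter // -scaleN1r; apply: lie_eltP.
    by rewrite -[k in lie_elt k](subrKC 1); apply: lie_elt_bracket => //; apply: lie_elt_gen.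
  by rewrite -scaleN1r; apply: lie_eltZ; apply: rho_lie.
have [m1|m1] := eqVneq m 1; have [n1'|n1'] := eqVneq n 1.
- move: hu hv; rewrite m1 n1' => /lie_elt1[x ->] /lie_elt1[y ->].
  split; first exact: right_leibniz_letters.
  have dl := @dLeib_linear K g.
  rewrite /tbracket (linD dl) (linN dl) (linZ dl) !dLeib_letters mul1r ksign1.
  rewrite scaleN1r opprK -opprD -scaleN1r; apply: lie_eltZ.
  by rewrite -[tword [:: leib x y]]scale1r; apply: lie_eltP; apply: lie_elt_gen.
- have [lv dv] := IHv n1'; move: hu; rewrite m1 => /lie_elt1[x ->].
  by rewrite (addrC 1 n) addrK; apply: letter.
- have [lu du] := IHu m1; move: hv; rewrite n1' => /lie_elt1[x ->].
  (* A letter on the right is moved to the left by antisymmetry. *)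
  have [h1 h2] := letter m x u hu lu du; rewrite tbracketC mul1r addrK.
  rewrite -[_ *: _]addr0; split.
    by apply: right_leibnizP => //; apply: right_leibniz0.
  by rewrite addr0 linearZ /=; apply: lie_eltZ.
have [lu du] := IHu m1; have [lv dv] := IHv n1'; split.
  rewrite /tbracket addrC -scaleNr; apply: right_leibnizP; exact: right_leibnizM.
rewrite dLeib_bracket // -[tbracket (m - 1) _ _ _]scale1r; apply: lie_eltP.
  by rewrite addrAC; apply: lie_elt_bracket.
by apply: lie_eltZ; rewrite -addrA; apply: lie_elt_bracket.
Qed.

Lemma lie_elt_dLeib n u : lie_elt n u -> lie_elt (n - 1) (dLeib u).
Proof.
move=> hu; have [n1|n1] := eqVneq n 1; last by case: (lie_elt_dLeib_gt1 hu).
move: hu; rewrite n1 => /lie_elt1[x ->]; rewrite dLeib_letter; exact: lie_elt0.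
Qed.

End DifferentialOnLie.

(** * The transferred structure *)

Section TransferredDifferential.
Variables (K : fieldType) (charK : [pchar K] =i pred0) (g : leibnizType K).
Local Notation P := (pirashvili g).

Fact transfer_linear : linear (fun u : sym P => psi (dLeib (theta u)) : sym P).
Proof. by have tl := theta_linear (V := g) charK; lin. Qed.

Definition transfer : {linear sym P -> sym P} :=
  HB.pack (fun u : sym P => psi (dLeib (theta u)) : sym P)
    (GRing.isLinear.Build K (sym P) (sym P) _ _ transfer_linear).

Lemma transferE u : transfer u = psi (dLeib (theta u)).
Proof. by []. Qed.

Lemma theta_single (x : homog P) : theta (sword [:: x]) = lie_val_of x.
Proof. by rewrite -(psi_val charK) (psiK charK). Qed.

(** The axioms hold for [dLeib] on the tensor coalgebra and are carried over by [psi], an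
    isomorphism of graded coalgebras. *)
Lemma transfer_Linfty : Linfty_structure transfer.
Proof.
have pl := @psi_linear K g; have tl := theta_linear (V := g) charK.
split=> [m u hu|u||u].
- exact/psi_degree/dLeib_degree/theta_degree.
- rewrite transferE comult_psi // tcomult_dLeib -[in RHS](thetaK charK u) comult_psi //.
  move: (tcomult _); apply: tens_ext => [||a b]; [lin|lin|].
  have e1 v w : tens_map (@psi K g) (@psi K g) (pure v w) = pure (psi v) (psi w).
    by rewrite tens_map_pure.
  rewrite (linD (tens_map_linear pl pl)) !tens_map_pure; do ?lin.
  by rewrite !transferE !psiK // psi_sign.
- by rewrite transferE theta_nil // dLeib_nil linear0.
- by rewrite !transferE psiK // dLeib_sq linear0.
Qed.

(** On single Lie elements [psi] and [theta] are identities, and [dLeib] preserves Lie elements. *)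
Lemma transfer_extends : extends_dLeib transfer.
Proof.
move=> n u.
have h : dLeib (lie_val u) \in lie_pred (n - 1).
  by apply/asboolP/lie_elt_dLeib; exact: (lie_val_elt (Tagged (free_lie g) u)).
exists (Lie h) => //.
have p1 (x : homog P) : sym_proj 1 (sword [:: x]) = sword [:: x] by rewrite sym_proj_sword.
rewrite /component /sym_incl p1 transferE theta_single.
by rewrite -[dLeib _]/(lie_val_of (Tagged (free_lie g) (Lie h))) psi_val // p1.
Qed.

End TransferredDifferential.

(** * Naturality of the transferred structure *)

Section Naturality.
Variables (K : fieldType) (charK : [pchar K] =i pred0) (g h : leibnizType K).
Variable f : {linear g -> h}.
Hypothesis fm : leibniz_morphism f.

Lemma tensor_map_rho x u : tensor_map f (rho x u) = rho (f x) (tensor_map f u).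
Proof.
move: u; apply: tensor_ext => [||s]; [lin|lin|].
elim: s => [|y s IH]; first by rewrite rho_nil linear0 tensor_map_word rho_nil.
rewrite tword_cons rhoM rho_letter linearD /= !tensor_mapM IH !tensor_map_word /=.
by rewrite rhoM rho_letter fm.
Qed.

Lemma tensor_map_dLeib u : tensor_map f (dLeib u) = dLeib (tensor_map f u).
Proof.
move: u; apply: tensor_ext => [||s]; [lin|lin|].
elim/last_ind: s => [|s x IH]; first by rewrite dLeib_nil linear0 tensor_map_word dLeib_nil.
rewrite tword_rcons dLeib_rletter linearD /= !tensor_mapM IH tensor_map_rho.
by rewrite tsign_word linearZ /= !tensor_map_word /= dLeib_rletter tsign_word size_map.
Qed.

(** Every element is some [psi t], so the naturality of [psi] and [dLeib] suffices and gives that of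
    [theta]. *)
Lemma transfer_natural (u : sym (pirashvili g)) :
  pirashvili_map f (transfer charK g u) = transfer charK h (pirashvili_map f u).
Proof.
rewrite -[u](thetaK charK) !transferE psiK // /pirashvili_map.
by rewrite !sym_map_psi psiK // tensor_map_dLeib.
Qed.

End Naturality.

(** * Homology in degree one and the induced bracket *)

Section DegreeOne.
Variables (K : fieldType) (g : leibnizType K).
Hypothesis charK : [pchar K] =i pred0.
Implicit Types (x y : g) (u v : tensor g).

Definition letter_of_word (s : seq g) : g := if s is [:: x] then x else 0.

Lemma letter_of_word_ml : multilinear letter_of_word.
Proof.
move=> [|x [|x' s1]] [|y' s2] a x1 x2 //=; by rewrite ?scaler0 ?addr0.
Qed.

Definition letter_of : tensor g -> g := tensor_lift letter_of_word.

Fact letter_of_linear : linear letter_of.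
Proof. exact: tensor_lift_linear letter_of_word_ml. Qed.
HB.instance Definition _ := GRing.isLinear.Build K (tensor g) g _ letter_of letter_of_linear.

Lemma letter_ofE x : letter_of (tword [:: x]) = x.
Proof. exact: (tensor_lift_word _ letter_of_word_ml). Qed.

(** Polarization of the square. *)
Lemma square_polar x y : lspan (@is_square K g) (leib x y + leib y x).
Proof.
have -> : leib x y + leib y x =
    1 *: leib (x + y) (x + y) + ((-1) *: leib x x + ((-1) *: leib y y + 0)).
  rewrite (linD (leib_linearl _)) !(linD (leib_linearr _)); modring.
by do 3![apply: lspanP; first by eexists]; apply: lspan0.
Qed.

(** Degree 2 is spanned by brackets of letters, whose differential is [- (x y + y x)] in Leibniz
    products. *)
Lemma letter_of_boundary u : lie_elt 2 u -> lspan (@is_square K g) (letter_of (dLeib u)).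
Proof.
suff h n : lie_elt n u -> n = 2 -> lspan (@is_square K g) (letter_of (dLeib u)) by move/h; apply.
elim=> [x|{}n|{}n a {}u v _ hu _ hv|m {}n {}u v hu _ hv _] n2.
- by rewrite dLeib_letter linear0; apply: lspan0.
- by rewrite !linear0; apply: lspan0.
- by rewrite !linearP /=; apply: lspanD; [apply/lspanZ/hu|apply: hv].
have [u0|m0] := lie_elt_gt0 hu.
  by rewrite u0 !tmulE scaler0 subr0 !linear0; apply: lspan0.
have [v0|n0] := lie_elt_gt0 hv.
  by rewrite v0 !tmulE scaler0 subr0 !linear0; apply: lspan0.
have [m1 n1] : m = 1 /\ n = 1 by split; lia.
move: hu hv; rewrite m1 n1 => /lie_elt1[x ->] /lie_elt1[y ->].
rewrite mul1r ksign1 scaleN1r opprK linearD /= !dLeib_letters -opprD.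
rewrite linearN linearD /= !letter_ofE; apply/lspanN/square_polar.
Qed.

Lemma cycle_genP (z : Defs.cycle g 1) : exists x, z = cycle_gen x.
Proof.
have /lie_elt1[x e] := lie_val_elt (Tagged (free_lie g) (cycle_val z)).
by exists x; apply: val_inj; apply: val_inj.
Qed.

Lemma cycle_gen_lin a x y : cycle_gen (a *: x + y) = a *: cycle_gen x + cycle_gen y.
Proof. by apply: val_inj; apply: val_inj; rewrite /= tword1_linear. Qed.

Lemma two_neq0 : 2%:R != 0 :> K.
Proof. by move/(pcharf0P K): charK => ->. Qed.

Lemma boundary_square x : boundary (cycle_gen (leib x x)).
Proof.
have h : (- tmul (tword [:: x]) (tword [:: x])) \in lie_pred (1 + 1).
  (* The bracket of the odd letter [x] with itself is twice its tensor square, so 2 must be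
     inverted. *)
  apply/asboolP; have -> : - tmul (tword [:: x]) (tword [:: x]) =
      (- 2%:R^-1 : K) *: tbracket 1 1 (tword [:: x]) (tword [:: x]).
    rewrite /tbracket mul1r ksign1 scaleN1r opprK -mulr2n -scaler_nat scalerA mulNr.
    by rewrite mulVf ?two_neq0 // scaleN1r.
  by apply/lie_eltZ/lie_elt_bracket; apply: lie_elt_gen.
by exists (Lie h); rewrite /= linearN /= dLeib_letters opprK.
Qed.

Definition homology1_letter (q : homology g 1) : gLie g :=
  cls (letter_of (lie_val (cycle_val (repr q)))).

(** Independence of the representative cycle: boundaries go to the span of squares. *)
Lemma homology1_letterE z :
  homology1_letter (cls z) = cls (letter_of (lie_val (cycle_val z))).
Proof.
apply/clsP; rewrite -linearB /=.
rewrite -[lie_val _ - lie_val _]/(lie_val (cycle_val (repr (cls z : homology g 1) - z))).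
have := repr_cls (@boundary K g 1) z.
rewrite -/(cls z : homology g 1).
elim=> [|a z1 z2 [b e] _ IH] /=; first by rewrite linear0; apply: lspan0.
rewrite linearP; apply/lspanD/IH/lspanZ.
rewrite e; apply: letter_of_boundary.
exact: (lie_val_elt (Tagged (free_lie g) b)).
Qed.

Fact homology1_letter_linear : linear homology1_letter.
Proof.
move=> a p q; elim/quotW: p => z1; elim/quotW: q => z2.
have -> : a *: cls z1 + cls z2 = cls (a *: z1 + z2) :> homology g 1 by rewrite linearP.
by rewrite !homology1_letterE /= !linearP.
Qed.
HB.instance Definition _ := GRing.isLinear.Build K (homology g 1) (gLie g) _
  homology1_letter homology1_letter_linear.

Lemma homology1_letter_gen x : homology1_letter (cls (cycle_gen x)) = cls x.
Proof. by rewrite homology1_letterE /= letter_ofE. Qed.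

(** The inverse sends the class of [x] to that of [cycle_gen x]; it is well defined because squares
    are boundaries. *)
Lemma homology1_letter_bij : bijective homology1_letter.
Proof.
exists (fun q => cls (cycle_gen (repr q))) => [|q]; last first.
  by rewrite homology1_letter_gen cls_repr.
elim/quotW=> z; have [x ->] := cycle_genP z; rewrite homology1_letter_gen.
apply/clsP; set y := repr _; have := repr_cls (@is_square K g) x.
rewrite -/y => h.
have -> : cycle_gen y - cycle_gen x = cycle_gen (y - x).
  by rewrite [y - x]addrC -[- x]scaleN1r cycle_gen_lin scaleN1r addrC.
elim: h => [|a _ u [v ->] _ IH].
  have := cycle_gen_lin (-1) 0 0; rewrite scaler0 addr0 scaleN1r addNr => ->.
  exact: lspan0.
by rewrite cycle_gen_lin; apply/lspanP/IH/boundary_square.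
Qed.

(** Here [theta] gives [x y - (x y + y x) / 2], that is [(x y - y x) / 2], and [dLeib] multiplies
    the letters with a minus sign. *)
Lemma transfer_letters x y :
  transfer charK g (sword [:: lie_letter x; lie_letter y]) =
  sword [:: lie_letter (- 2%:R^-1 *: (leib x y - leib y x))].
Proof.
have tl := theta_linear (V := g) charK.
have -> : lie_letter (- 2%:R^-1 *: (leib x y - leib y x)) =
  lie_homog 1 (tword [:: - 2%:R^-1 *: (leib x y - leib y x)]).
  by rewrite -[LHS](lie_homog_val (erefl (tag (lie_letter _)))).
rewrite transferE -sym_cons_sword theta_cons // theta_single // -[sword [:: _]]sym_cons_sword.
rewrite delta_cons delta_nil sym_cons0 scaler0 addr0 sym_cons_sword theta_single //.
rewrite -(psi_val charK) lie_homogE; last exact: lie_elt_gen.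
congr psi; rewrite euler_bracketE -[lie_val_of (lie_letter x)]/(tword [:: x]).
rewrite -[lie_val_of (lie_letter y)]/(tword [:: y]) -[tag (lie_letter x)]/(1 : int).
rewrite -[tag (lie_letter y)]/(1 : int) /tbracket mul1r ksign1.
have dl := @dLeib_linear K g; have t1 := @tword1_linear K g.
rewrite !(linD dl, linN dl, linZ dl) !dLeib_letters !(linZ t1, linD t1, linN t1).
have -> : (1%:~R / (1 + 1)%:~R : K) = 2%:R^-1 by rewrite mul1r.
(* As [ring] treats the inverse of 2 as an atom, one occurrence is rescaled by hand. *)
have {1}-> : tword [:: leib x y] = (2%:R * 2%:R^-1 : K) *: tword [:: leib x y].
  by rewrite divff ?scale1r // two_neq0.
modring.
Qed.

(** In Leibniz products, [- (x y - y x) / 2] and [- x y] differ by [(x y + y x) / 2], a combination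
    of squares; hence the sign is -1. *)
Lemma transfer_bracket : induces_bracket (transfer charK g) true.
Proof.
pose phi : {linear homology g 1 -> gLie g} := homology1_letter; exists phi.
have phiE x : phi (cls (cycle_gen x)) = cls x by exact: homology1_letter_gen.
split; [exact: homology1_letter_bij | exact: homology1_letter_gen |].
move=> z1 z2; have [x ->] := cycle_genP z1; have [y ->] := cycle_genP z2.
exists (cycle_gen (- 2%:R^-1 *: (leib x y - leib y x))).
  rewrite /component sym_proj_sword eqxx.
  by rewrite (transfer_letters x y) sym_proj_sword.
rewrite !phiE gLie_bracketE expr1 scaleN1r -linearN.
apply/clsP; rewrite opprK.
have -> : - 2%:R^-1 *: (leib x y - leib y x) + leib x y = 2%:R^-1 *: (leib x y + leib y x).
  have {2}-> : leib x y = (2%:R * 2%:R^-1 : K) *: leib x y.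
    by rewrite divff ?scale1r // two_neq0.
  modring.
exact/lspanZ/square_polar.
Qed.

End DegreeOne.

Theorem theorem4 (K : fieldType) (charK : [pchar K] =i pred0) :
  exists d : forall g : leibnizType K,
               {linear sym (pirashvili g) -> sym (pirashvili g)},
  [/\ forall g : leibnizType K, Linfty_structure (d g),
      forall g : leibnizType K, extends_dLeib (d g),
      forall (g h : leibnizType K) (f : {linear g -> h}),
        leibniz_morphism f ->
        forall u : sym (pirashvili g),
          pirashvili_map f (d g u) = d h (pirashvili_map f u) &
      exists b : bool, forall g : leibnizType K, induces_bracket (d g) b].
Proof.
exists (transfer charK); split.
- exact: transfer_Linfty.
- exact: transfer_extends.
- exact: transfer_natural.
- by exists true => g; apply: transfer_bracket.
Qed.
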